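(* There exist absolute constants $c,C>0$ such that the following holds. Let $f_1,\dots,f_n:\mathbb R^d\to\mathbb R$ be such that $f_i$ is differentiable with $\|\nabla f_i(x)-\nabla f_i(y)\|^2\le L_i^2\|x-y\|^2$ for all $x,y$ ($L_i>0$), let $L^2=\frac1n\sum_i L_i^2$, $f=\frac1n\sum_i f_i$, and suppose there are $\delta,\sigma\ge0$ with $\|\nabla f_i(x)-\nabla f(x)\|^2\le\delta^2\|\nabla f(x)\|^2+\sigma^2$ for all $x\in\mathbb R^d$ and all $i$. Let $x^*$ be a minimizer of $f$. Let $(x^t)$ be generated by Markovian QSGD with step size $\gamma>0$ and compressors $Q^i_t$ that are random sparsifications driven by ergodic Markov chains with uniform stationary distribution. Put $F_t:=\mathbb E[f(x^t)-f(x^* )]$. (1) For any $\varepsilon>0$, $\gamma>0$, $\tau>\tau_{\rm mix}(\varepsilon)$ and $T>\tau$ satisfying $$\gamma\le c\,\frac{m^2}{d^2L(\delta^2+1)\tau},\qquad \varepsilon\le c\,\frac{m^2}{d^2(\delta^2+1)},$$ it holds that $$\mathbb E\|\nabla f(\widehat x^T)\|^2\le C\left(\frac{F_\tau}{\gamma T}+\frac{\gamma L\tau d^2}{m^2}\sigma^2\right),$$ where $\widehat x^T$ is chosen uniformly from $\{x^t\}_{t=0}^T$. (2) If $f$ additionally satisfies the PL-condition $\|\nabla f(x)\|^2\ge2\mu(f(x)-f(x^* ))$ for all $x\in\mathbb R^d$ with some $\mu>0$, then for any $\varepsilon>0$, $\gamma>0$, $\tau>\tau_{\rm mix}(\varepsilon)$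 and $T>\tau$ satisfying $$\gamma\le c\,\frac{m^2}{Ld^2\tau(\delta^2+1)},\qquad \varepsilon=\sqrt{\gamma L\tau}\le c\,\frac{m}{d\sqrt{\delta^2+1}},$$ it holds that $$F_T\le C\left(\Big(1-\frac{\mu\gamma}{12}\Big)^{T-\tau}F_\tau+\frac{\gamma d^2L\tau}{\mu m^2}\sigma^2\right).$$
   Context: Markovian QSGD: given $x^0\in\mathbb R^d$ and $\gamma>0$, for $t=0,1,\dots,T$ set $g^t_i=Q^i_t(\nabla f_i(x^t))$ for $i=1,\dots,n$, $g^t=\frac1n\sum_{i=1}^n g^t_i$, and $x^{t+1}=x^t-\gamma g^t$. Compressors: for each worker $i$, $Q^i_t(x)=\frac dm\,x\odot\mathbb 1(\nu^i_t)$, where $\nu^i_t\subseteq\{1,\dots,d\}$ has size $m$ ($1\le m\le d$), $\mathbb 1(\nu)$ is the indicator vector of $\nu$, $\odot$ is the coordinatewise product, and $(\nu^i_t)_{t\ge0}$ is a realization of an ergodic Markov chain with uniform stationary distribution (uniform over the $\binom dm$ subsets of size $m$). Mixing time: for an ergodic finite chain with stationary distribution $(p_s)$ and $p_{\min}=\min_s p_s$, $\tau_{\rm mix}(\varepsilon)$ is a time such that for all $t\ge\tau_{\rm mix}(\varepsilon)$ and every initial state $s_0$, $\max_s|\mathbb P\{X_t=s\mid X_0=s_0\}-p_s|\le\varepsilon\, p_{\min}$; here $\tau_{\rm mix}(\varepsilon)$ is taken to be valid for the chains of all workers. $\|\cdot\|$ is the Euclidean norm; times $\tau,T$ are integers.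 *)

(* Defs.v *)
From HB Require Import structures.
From mathcomp Require Import all_boot all_order all_algebra.
From mathcomp Require Import all_classical all_reals all_analysis.

Set Implicit Arguments.
Unset Strict Implicit.
Unset Printing Implicit Defensive.

Import Order.TTheory GRing.Theory Num.Theory.
Import numFieldNormedType.Exports.

Local Open Scope classical_set_scope.
Local Open Scope ring_scope.

Section Euclidean.
Context {R : realType} {d : nat}.

(* The library norm on ['rV[R]_d] is the sup norm. *)
Definition enorm (v : 'rV[R]_d) : R := Num.sqrt (\sum_(j < d) v 0 j ^+ 2).

Definition grad (f : 'rV[R]_d -> R) (x : 'rV[R]_d) : 'rV[R]_d :=
  \row_(j < d) 'D_(delta_mx 0 j) f x.

Definition favg {n : nat} (f : 'I_n -> 'rV[R]_d -> R) (x : 'rV[R]_d) : R :=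
  n%:R^-1 * \sum_(i < n) f i x.

End Euclidean.

Section FiniteChain.
Context {R : realType} {S : finType}.
Implicit Types (K : S -> S -> R) (p : S -> R).

(* [K s s'] is the probability of a transition from [s] to [s']. *)
Definition transition_matrix K : Prop :=
  (forall s s', 0 <= K s s') /\ (forall s, \sum_(s' : S) K s s' = 1).

Fixpoint kstep K (t : nat) (s s' : S) : R :=
  if t is t'.+1 then \sum_(u : S) K s u * kstep K t' u s' else (s == s')%:R.

Definition irreducible_chain K : Prop :=
  forall s s', exists t, 0 < kstep K t s s'.

Definition aperiodic_chain K : Prop :=
  forall s (q : nat),
    (forall t, (0 < t)%N -> 0 < kstep K t s s -> (q %| t)%N) -> q = 1%N.

Definition ergodic_chain K : Prop := irreducible_chain K /\ aperiodic_chain K.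

Definition stationary_distribution K p : Prop :=
  [/\ forall s, 0 <= p s, \sum_(s : S) p s = 1
    & forall s', \sum_(s : S) p s * K s s' = p s'].

Definition uniform_distribution (_ : S) : R := #|S|%:R^-1.

(* The default value 1 is harmless: probabilities do not exceed 1. *)
Definition pmin p : R := \big[Num.min/1]_(s : S) p s.

Definition mixing_time K p (eps : R) (tm : nat) : Prop :=
  forall t, (tm <= t)%N ->
    forall s0 s, `|kstep K t s0 s - p s| <= eps * pmin p.

End FiniteChain.

Definition mask_set (d m : nat) := {A : {set 'I_d} | #|A| == m}.

Section Processes.
Context {R : realType} {disp : measure_display} {Omega : measurableType disp}.
Variable P : probability Omega R.
Context {n : nat} {S : finType}.
Variable nu : 'I_n -> nat -> Omega -> S.

Definition measurable_process : Prop :=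
  forall i t s, measurable [set w | nu i t w = s].

(* The event that all [n] processes follow the trajectories [h] up to time [t]. *)
Definition history (t : nat) (h : 'I_n -> nat -> S) : set Omega :=
  [set w | forall i s, (s <= t)%N -> nu i s w = h i s].

(* The i-th process is a time-homogeneous Markov chain with kernel [K] with
   respect to the common filtration of all the processes:
   Pr(nu^i_{t+1} = s | history up to t) = K (nu^i_t) s, written without
   conditioning on null events.  The initial law is arbitrary.  Mutually
   independent Markov chains have this property. *)
Definition markov_chain (i : 'I_n) (K : S -> S -> R) : Prop :=
  forall t h s,
    P (history t h `&` [set w | nu i t.+1 w = s]) =
    (P (history t h) * (K (h i t) s)%:E)%E.

(* [J] is uniform on {0,...,T} and independent of the processes up to time T. *)
Definition uniform_index (T : nat) (J : Omega -> 'I_T.+1) : Prop :=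
  [/\ forall k, measurable [set w | J w = k],
      forall k, P [set w | J w = k] = (T.+1%:R^-1)%:E
    & forall k h, P ([set w | J w = k] `&` history T h) =
        (P [set w | J w = k] * P (history T h))%E].

End Processes.

Section QSGD.
Context {R : realType} {d m n : nat}.

Definition compress (A : mask_set d m) (x : 'rV[R]_d) : 'rV[R]_d :=
  (d%:R / m%:R) *: \row_(j < d) (x 0 j * (j \in val A)%:R).

Fixpoint qsgd {Omega : Type} (f : 'I_n -> 'rV[R]_d -> R)
    (nu : 'I_n -> nat -> Omega -> mask_set d m) (gamma : R) (x0 : 'rV[R]_d)
    (t : nat) (w : Omega) : 'rV[R]_d :=
  if t is t'.+1 then
    let x := qsgd f nu gamma x0 t' w in
    x - gamma *: (n%:R^-1 *: \sum_(i < n) compress (nu i t' w) (grad (f i) x))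
  else x0.

End QSGD.

(* F_t = E[f(x^t) - f(x_star)] for the average f of the [f i]. *)
Definition Fgap {R : realType} {disp : measure_display}
    {Omega : measurableType disp} (P : probability Omega R) {d m n : nat}
    (f : 'I_n -> 'rV[R]_d -> R) (nu : 'I_n -> nat -> Omega -> mask_set d m)
    (xstar x0 : 'rV[R]_d) (gamma : R) (t : nat) : \bar R :=
  'E_P[fun w => (favg f (qsgd f nu gamma x0 t w) - favg f xstar)%R]%E.

(* Main.v *)
Require Import Defs.
From HB Require Import structures.
From mathcomp Require Import all_boot all_order all_algebra.
From mathcomp Require Import all_classical all_reals all_analysis.
From mathcomp Require Import perm ring lra.

Set Implicit Arguments.
Unset Strict Implicit.
Unset Printing Implicit Defensive.

Import Order.TTheory GRing.Theory Num.Theory.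
Import numFieldNormedType.Exports.

Local Open Scope classical_set_scope.
Local Open Scope ring_scope.

(** Write [D = d / m], [G] for the gradient of the mean function [f], and [eta
    = gamma L tau D^2]. The step size condition says that [eta (delta^2 + 1)]
    is at most a small constant.

    The update direction is the gradient plus a noise that is linear in the
    functions [D 1(j in nu) - 1] of the masks. These have mean zero under the
    uniform law, but the masks are correlated in time, and an argument that
    waits for [tau] steps and accepts the bias [eps] left by mixing would
    leave a noise term of order [eps^2 sigma^2] that does not vanish with
    [gamma]. Instead the noise is removed exactly. For every worker [i] and
    coordinate [j] the Poisson equation [a - K_i a = D 1(j in nu) - 1] has a
    solution bounded by [2 tau D] ([poisson_equation]): mixing up to 1/2 after
    [tau] steps makes the equation uniquely solvable and bounds the solution.

    Let [H(x, nu)] be the scalar product of [G x] with the mean over the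
    workers of their gradients rescaled by [a], and [KH] the same with [K_i a]
    in place of [a]. Then the noise is [H(x^t, nu_t) - KH(x^t, nu_t)], and by
    the Markov property [H(x^{t+1}, nu_{t+1})] and [KH(x^{t+1}, nu_t)] have
    the same mean ([mean_correction]). So the potential [V_t = E (f(x^t) -
    f(x_star) - gamma KH(x^t, nu_{t-1}))] satisfies, for [t >= 1], [V_{t+1} <=
    V_t - (gamma / 2) E |G(x^t)|^2 + O(gamma eta sigma^2)]
    ([potential_decrease]), where the error comes from the change of [KH] over
    one step ([corrector_step_le]) and the quadratic term of the descent
    lemma. It stays within a quarter of the gap [F_t] plus [O(gamma tau eta
    sigma^2)] of [F_t] ([potential_gap_close]).

    Summing over [t >= tau] bounds the late gradients, and the gradients
    before time [tau] are controlled by the one at time [tau], since the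
    iterate hardly moves in [tau] steps ([early_gradients_le]); this gives the
    first rate ([sum_sqgrad_le]). Under the PL condition the inequality is a
    contraction, which gives the second ([gap_le_PL]). The constants are [c =
    1/64] and [C = 300].

    The iterates are functions of finitely many masks, so all expectations are
    finite sums over trajectories ([expectation_traj]). *)

(** * Euclidean geometry of row vectors *)

Section DotProduct.
Context {R : realType} {d : nat}.
Implicit Types u v : 'rV[R]_d.

Definition dotp u v : R := \sum_(j < d) u 0 j * v 0 j.
Definition nsq v : R := dotp v v.

Lemma nsq_ge0 v : 0 <= nsq v.
Proof. by apply: sumr_ge0 => j _; rewrite -expr2 sqr_ge0. Qed.

Lemma enorm_sqr v : enorm v ^+ 2 = nsq v.
Proof.
rewrite /enorm sqr_sqrtr; last by apply: sumr_ge0 => j _; rewrite sqr_ge0.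
by apply: eq_bigr => j _; rewrite expr2.
Qed.

Lemma dotpC u v : dotp u v = dotp v u.
Proof. by apply: eq_bigr => j _; rewrite mulrC. Qed.

Lemma dotpDl u1 u2 v : dotp (u1 + u2) v = dotp u1 v + dotp u2 v.
Proof. by rewrite -big_split; apply: eq_bigr => j _ /=; rewrite mxE mulrDl. Qed.

Lemma dotpZl k u v : dotp (k *: u) v = k * dotp u v.
Proof. by rewrite mulr_sumr; apply: eq_bigr => j _; rewrite mxE mulrA. Qed.

Lemma dotpNl u v : dotp (- u) v = - dotp u v.
Proof. by rewrite -scaleN1r dotpZl mulN1r. Qed.

Lemma dotpDr u v1 v2 : dotp u (v1 + v2) = dotp u v1 + dotp u v2.
Proof. by rewrite dotpC dotpDl !(dotpC u). Qed.

Lemma dotpZr k u v : dotp u (k *: v) = k * dotp u v.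
Proof. by rewrite dotpC dotpZl dotpC. Qed.

Lemma dotpNr u v : dotp u (- v) = - dotp u v.
Proof. by rewrite dotpC dotpNl dotpC. Qed.

Lemma dotp_suml (I : finType) (u : I -> 'rV[R]_d) v :
  dotp (\sum_i u i) v = \sum_i dotp (u i) v.
Proof.
rewrite exchange_big /=; apply: eq_bigr => j _.
by rewrite summxE mulr_suml.
Qed.

Lemma dotp_sumr (I : finType) u (v : I -> 'rV[R]_d) :
  dotp u (\sum_i v i) = \sum_i dotp u (v i).
Proof. by rewrite dotpC dotp_suml; apply: eq_bigr => i _; rewrite dotpC. Qed.

Definition dotpE := (dotpDl, dotpDr, dotpZl, dotpZr, dotpNl, dotpNr).

Lemma nsqZ k v : nsq (k *: v) = k ^+ 2 * nsq v.
Proof. by rewrite /nsq !dotpE mulrA expr2. Qed.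

Lemma nsqB u v : nsq (u - v) = nsq u - 2 * dotp u v + nsq v.
Proof. by rewrite /nsq !dotpE (dotpC v u); ring. Qed.

Lemma nsq_sub_sym u v : nsq (u - v) = nsq (v - u).
Proof. by rewrite !nsqB (dotpC v u); ring. Qed.

(** Weighted AM-GM takes the place of Cauchy-Schwarz throughout, so that only
    squared norms occur; the weight is chosen so as to balance the two sides.
    *)
Lemma dotp_young k u v : 0 < k -> dotp u v <= (k * nsq u + nsq v / k) / 2.
Proof.
move=> k0; have := nsq_ge0 (k *: u - v); rewrite nsqB nsqZ dotpZl => h.
rewrite -(ler_pM2l (_ : 0 < 2 * k)); last by rewrite mulr_gt0.
have -> : 2 * k * ((k * nsq u + nsq v / k) / 2) = k ^+ 2 * nsq u + nsq v.
  by field; rewrite gt_eqF.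
by rewrite -subr_ge0; move: h; congr (_ <= _); ring.
Qed.

Lemma normr_dotp_young k u v : 0 < k ->
  `|dotp u v| <= (k * nsq u + nsq v / k) / 2.
Proof.
move=> k0; rewrite ler_norml dotp_young // andbT lerNl -dotpNr.
by apply: le_trans (dotp_young _ _ k0) _; rewrite /nsq !dotpE opprK.
Qed.

Lemma nsqD_le u v : nsq (u + v) <= 2 * nsq u + 2 * nsq v.
Proof.
have := nsq_ge0 (u - v); rewrite nsqB => h.
by rewrite {1}/nsq !dotpE (dotpC v u) -/(nsq u) -/(nsq v); lra.
Qed.

(** Twice the difference of the two sides is the sum over all pairs [(i, k)]
    of [nsq (v i - v k)]. *)
Lemma nsq_sum_le (I : finType) (v : I -> 'rV[R]_d) :
  nsq (\sum_i v i) <= #|I|%:R * \sum_i nsq (v i).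
Proof.
have h : 0 <= \sum_i \sum_k nsq (v i - v k).
  by do 2![apply: sumr_ge0 => ? _]; exact: nsq_ge0.
have e1 : \sum_i \sum_(k : I) nsq (v i) = #|I|%:R * \sum_i nsq (v i).
  by rewrite mulr_sumr; apply: eq_bigr => i _; rewrite sumr_const mulr_natl.
have e2 : \sum_(i : I) \sum_k nsq (v k) = #|I|%:R * \sum_i nsq (v i).
  by rewrite sumr_const mulr_natl.
have e3 : \sum_i \sum_k dotp (v i) (v k) = nsq (\sum_i v i).
  by rewrite /nsq dotp_suml; apply: eq_bigr => i _; rewrite dotp_sumr.
suff e : \sum_i \sum_k nsq (v i - v k) =
    2 * (#|I|%:R * \sum_i nsq (v i)) - 2 * nsq (\sum_i v i).
  by rewrite e in h; lra.
rewrite -e3; under eq_bigr do under eq_bigr do rewrite nsqB.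
under eq_bigr do rewrite big_split /= big_split /= sumrN.
rewrite big_split /= big_split /= sumrN e1 e2.
under [X in _ - X + _]eq_bigr do rewrite -mulr_sumr.
by rewrite -mulr_sumr; ring.
Qed.

Lemma nsq_avg_le (n : nat) (v : 'I_n -> 'rV[R]_d) : (0 < n)%N ->
  nsq (n%:R^-1 *: \sum_i v i) <= n%:R^-1 * \sum_i nsq (v i).
Proof.
move=> n0; rewrite nsqZ expr2 -mulrA ler_pM2l ?invr_gt0 ?ltr0n //.
rewrite mulrC ler_pdivrMr ?ltr0n // mulrC.
by have := nsq_sum_le v; rewrite card_ord.
Qed.

End DotProduct.

(** * Smooth functions *)

Section Smooth.
Context {R : realType} {d : nat}.
Implicit Types (F : 'rV[R]_d -> R) (x y v : 'rV[R]_d).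

Lemma derive_dotp F x v : differentiable F x -> 'D_v F x = dotp (grad F x) v.
Proof.
move=> dF; rewrite deriveE // {1}(row_sum_delta v) linear_sum.
by apply: eq_bigr => j _; rewrite linearZ /= -deriveE // mxE mulrC.
Qed.

Lemma grad_favg n (f : 'I_n -> 'rV[R]_d -> R) x :
  (forall i, differentiable (f i) x) ->
  grad (favg f) x = n%:R^-1 *: \sum_(i < n) grad (f i) x.
Proof.
move=> df; apply/rowP => j; rewrite !mxE summxE.
have dfj i : derivable (f i) x (delta_mx 0 j) by exact: diff_derivable.
have -> : favg f = n%:R^-1 *: (\sum_(i < n) f i).
  by apply/funext => y; rewrite /favg /= fct_sumE.
rewrite deriveZ; last exact: derivable_sum.
rewrite derive_sum //; congr (_ * _).
by apply: eq_bigr => i _; rewrite mxE.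
Qed.

Lemma differentiable_favg n (f : 'I_n -> 'rV[R]_d -> R) x :
  (forall i, differentiable (f i) x) -> differentiable (favg f) x.
Proof.
move=> df; have -> : favg f = n%:R^-1 *: (\sum_(i < n) f i).
  by apply/funext => y; rewrite /favg /= fct_sumE.
by apply: differentiableZ; apply: differentiable_sum.
Qed.

Lemma is_derive_line F x v (s : R) : (forall y, differentiable F y) ->
  is_derive s 1 (fun s : R => F (x + s *: v)) (dotp (grad F (x + s *: v)) v).
Proof.
move=> dF; have dFs : derivable F (x + s *: v) v by exact: diff_derivable.
have e : (fun h : R => h^-1 *: ((fun s => F (x + s *: v)) (h *: 1 + s)
      - F (x + s *: v))) =
    (fun h : R => h^-1 *: ((F \o shift (x + s *: v)) (h *: v) - F (x + s *: v))).
  apply/funext => h; congr (_ *: (F _ - _)) => /=.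
  by rewrite [h *: 1]mulr1 scalerDl addrCA addrA.
apply: DeriveDef; first by rewrite /derivable /= e.
by rewrite -derive_dotp // /derive /= e.
Qed.

Section Lipschitz.
Variables (F : 'rV[R]_d -> R) (L : R).
Hypothesis dF : forall y, differentiable F y.
Hypothesis L0 : 0 < L.
Hypothesis lipF : forall x y, nsq (grad F x - grad F y) <= L ^+ 2 * nsq (x - y).

(** The mean value theorem along the segment replaces the integral form of the
    remainder; it costs a factor 2 in the quadratic term. *)
Lemma descent x v : F (x + v) <= F x + dotp (grad F x) v + L * nsq v.
Proof.
have cont : {within `[0, 1], continuous (fun s : R => F (x + s *: v))}.
  apply: continuous_subspaceT => s.
  apply: differentiable_continuous; apply/derivable1_diffP.
  by have [] := is_derive_line x v s dF.
have [s] := MVT (@ltr01 R) (fun s _ => is_derive_line x v s dF) cont.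
rewrite in_itv/= => /andP[s0 s1]; rewrite scale1r scale0r addr0 subr0 mulr1 => e.
have -> : F (x + v) = F x + dotp (grad F x) v
    + dotp (grad F (x + s *: v) - grad F x) v.
  by rewrite dotpDl dotpNl; lra.
rewrite lerD2l.
have k0 : 0 < L^-1 by rewrite invr_gt0.
apply: le_trans (dotp_young _ _ k0) _.
have := lipF (x + s *: v) x; rewrite addrAC subrr add0r nsqZ => h.
have h2 : s ^+ 2 * nsq v <= nsq v.
  by rewrite ler_piMl ?nsq_ge0 // expr_le1 // ltW.
have h3 : L^-1 * nsq (grad F (x + s *: v) - grad F x) <= L * nsq v.
  rewrite ler_pdivrMl //; apply: le_trans h _.
  by rewrite (mulrA L L) -expr2 ler_pM2l // exprn_gt0.
rewrite invrK (mulrC _ L); lra.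
Qed.

(** A gradient step of length [1 / (2 L)] decreases [F] by at least [nsq (grad
    F x) / (4 L)], and it cannot go below the minimum. *)
Lemma nsq_grad_le xstar x : (forall y, F xstar <= F y) ->
  nsq (grad F x) <= 4 * L * (F x - F xstar).
Proof.
move=> /(_ (x + (- (2 * L)^-1) *: grad F x)) h.
have := le_trans h (descent _ _); rewrite dotpZr nsqZ -/(nsq _) => {}h.
have e : L * ((- (2 * L)^-1) ^+ 2 * nsq (grad F x)) = (4 * L)^-1 * nsq (grad F x).
  by field; rewrite gt_eqF.
have e2 : (2 * L)^-1 * nsq (grad F x) = 2 * ((4 * L)^-1 * nsq (grad F x)).
  by field; rewrite gt_eqF.
rewrite -ler_pdivrMl; last by rewrite mulr_gt0.
by move: h; rewrite e mulNr e2; lra.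
Qed.

End Lipschitz.
End Smooth.

(** * The Poisson equation of a mixing chain *)

Section Poisson.
Context {R : realType} {S : finType}.
Variables (K : S -> S -> R) (p : S -> R).
Implicit Types (a h phi : S -> R) (B : R).

Definition kop a (s : S) : R := \sum_s' K s s' * a s'.

Lemma iter_kopE t a s : iter t kop a s = \sum_s' kstep K t s s' * a s'.
Proof.
elim: t s => [|t IH] s /=.
  rewrite (bigD1 s) //= eqxx mul1r big1 ?addr0 // => s' /negbTE.
  by rewrite eq_sym => ->; rewrite mul0r.
transitivity (\sum_u K s u * iter t kop a u) => //.
transitivity (\sum_u \sum_s' K s u * (kstep K t u s' * a s')).
  by apply: eq_bigr => u _; rewrite (IH u) mulr_sumr.
rewrite exchange_big /=; apply: eq_bigr => s' _.
by rewrite mulr_suml; apply: eq_bigr => u _; rewrite mulrA.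
Qed.

Hypothesis trK : transition_matrix K.

Lemma kopB a h s : kop (fun u => a u - h u) s = kop a s - kop h s.
Proof. by rewrite /kop -sumrB; apply: eq_bigr => u _; rewrite mulrBr. Qed.

Lemma kop_le_sup a B : (forall s, `|a s| <= B) -> forall s, `|kop a s| <= B.
Proof.
move=> aB s; have [K0 K1] := trK.
apply: le_trans (ler_norm_sum _ _ _) _.
rewrite -[leRHS]mul1r -(K1 s) mulr_suml; apply: ler_sum => u _.
by rewrite normrM ger0_norm // ler_wpM2l.
Qed.

Hypothesis statK : stationary_distribution K p.

Lemma sum_kop_stationary h : \sum_s p s * kop h s = \sum_s p s * h s.
Proof.
have [_ _ pK] := statK.
under eq_bigr do rewrite mulr_sumr.
rewrite exchange_big /=; apply: eq_bigr => u _.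
by rewrite -pK mulr_suml; apply: eq_bigr => s _; rewrite mulrA.
Qed.

Variable tau : nat.
Hypothesis mixK : forall s, \sum_u `|kstep K tau s u - p u| <= 2^-1.

(** Mixing makes [K ^ tau] a contraction by 1/2, in the supremum norm, on the
    functions of mean zero, whereas [h - K ^ tau h] is the sum of the
    functions [K ^ t phi] with [t < tau]. Hence [sup |h| <= tau B + sup |h| /
    2]. *)
Lemma poisson_sup_le phi h B :
  (forall s, h s - kop h s = phi s) -> \sum_s p s * h s = 0 ->
  (forall s, `|phi s| <= B) -> forall s, `|h s| <= 2 * tau%:R * B.
Proof.
move=> hphi mean0 phiB.
have tel t s : `|h s - iter t kop h s| <= t%:R * B.
  elim: t s => [|t IH] s /=; first by rewrite subrr normr0 mul0r.
  have -> : h s - kop (iter t kop h) s =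
      phi s + kop (fun u => h u - iter t kop h u) s.
    by rewrite kopB -hphi; ring.
  apply: le_trans (ler_normD _ _) _.
  rewrite -natr1 mulrDl mul1r addrC lerD //.
  exact: kop_le_sup.
pose N := \big[Order.max/0]_s `|h s|.
have hN s : `|h s| <= N by exact: le_bigmax.
have contr s : `|iter tau kop h s| <= 2^-1 * N.
  have -> : iter tau kop h s = \sum_u (kstep K tau s u - p u) * h u.
    under eq_bigr do rewrite mulrBl.
    by rewrite sumrB mean0 subr0 iter_kopE.
  apply: le_trans (ler_norm_sum _ _ _) _.
  apply: (@le_trans _ _ ((\sum_u `|kstep K tau s u - p u|) * N)).
    by rewrite mulr_suml; apply: ler_sum => u _; rewrite normrM ler_wpM2l.
  by rewrite ler_wpM2r // /N; apply: bigmax_ge_id.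
have hle s : `|h s| <= tau%:R * B + 2^-1 * N.
  rewrite -[h s](subrK (iter tau kop h s)).
  by apply: le_trans (ler_normD _ _) _; rewrite lerD.
suff NB : N <= 2 * tau%:R * B by move=> s; exact: le_trans (hN s) NB.
have : N <= Num.max 0 (tau%:R * B + 2^-1 * N).
  apply: bigmax_le => [|s _]; first by rewrite le_max lexx.
  by rewrite le_max hle orbT.
rewrite le_max => /orP[N0|]; last by rewrite -mulrA; lra.
have {N0} N0 : N = 0 by apply/eqP; rewrite eq_le N0; exact: bigmax_ge_id.
case: (pickP S) => [s _|S0]; last first.
  have [_ + _] := statK; rewrite big_pred0 // => /esym/eqP.
  by rewrite oner_eq0.
have B0 : 0 <= B by exact: le_trans (phiB s).
by rewrite N0 !mulr_ge0.
Qed.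

(** The operator [I - K + 1 p], where [1 p] replaces a function by its mean,
    preserves means because [p] is stationary. A function of its kernel thus
    has mean zero, solves the equation for [phi = 0], and vanishes by the
    previous bound. So the operator is invertible, and on the preimage of
    [phi] the rank-one term is zero. This avoids summing the series of the [K
    ^ t phi]. *)
Lemma poisson_equation phi B :
  \sum_s p s * phi s = 0 -> (forall s, `|phi s| <= B) ->
  exists2 h, (forall s, h s - kop h s = phi s) &
             forall s, `|h s| <= 2 * tau%:R * B.
Proof.
move=> mphi phiB; have [_ p1 _] := statK.
(* The transpose of the operator, as matrices act on row vectors. *)
pose A : 'M[R]_#|S| := \matrix_(i, j)
  ((i == j)%:R - K (enum_val j) (enum_val i) + p (enum_val i)).
have vA (v : 'rV_#|S|) s (h := fun s => v 0 (enum_rank s)) :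
    (v *m A) 0 (enum_rank s) = h s - kop h s + \sum_u p u * h u.
  rewrite mxE (reindex enum_rank) /=; last exact/onW_bij/enum_rank_bij.
  under eq_bigr do rewrite mxE !enum_rankK !mulrDr mulrN.
  rewrite !big_split /= sumrN; congr (_ - _ + _).
  - rewrite (bigD1 s) //= eqxx mulr1 big1 ?addr0 // => u us.
    by rewrite (inj_eq enum_rank_inj) (negbTE us) mulr0.
  - by apply: eq_bigr => u _; rewrite mulrC.
  - by apply: eq_bigr => u _; rewrite mulrC.
have mean0 (v : 'rV_#|S|) phi' (h := fun s => v 0 (enum_rank s)) :
    \sum_s p s * phi' s = 0 ->
    (forall s, (v *m A) 0 (enum_rank s) = phi' s) -> \sum_u p u * h u = 0.
  move=> m0 e; transitivity (\sum_s p s * phi' s) => //.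
  under [RHS]eq_bigr do rewrite -e vA mulrDr mulrBr.
  rewrite big_split /= sumrB sum_kop_stationary subrr add0r.
  by rewrite -mulr_suml p1 mul1r.
have A_unit : A \in unitmx.
  rewrite -row_free_unit; apply: inj_row_free => v vA0.
  have m0 := @mean0 v (fun=> 0).
  apply/rowP => i; rewrite mxE -[i]enum_valK; apply/eqP; rewrite -normr_le0.
  have z0 : \sum_s p s * (0 : R) = 0 by rewrite big1 // => s _; rewrite mulr0.
  have e0 s : (v *m A) 0 (enum_rank s) = 0 by rewrite vA0 mxE.
  have := @poisson_sup_le (fun=> 0) (fun s => v 0 (enum_rank s)) 0 _ _ _ (enum_val i).
  rewrite mulr0; apply.
  - by move=> s; rewrite -[RHS](e0 s) vA (m0 z0 e0) addr0.
  - exact: m0.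
  - by move=> s; rewrite normr0.
pose v := (\row_i phi (enum_val i)) *m invmx A.
have ev s : (v *m A) 0 (enum_rank s) = phi s.
  by rewrite mulmxKV // mxE enum_rankK.
have m0 := mean0 v phi mphi ev.
have hphi s : v 0 (enum_rank s) - kop (fun s => v 0 (enum_rank s)) s = phi s.
  by rewrite -[RHS]ev vA m0 addr0.
exists (fun s => v 0 (enum_rank s)) => // s.
exact: (poisson_sup_le hphi).
Qed.

End Poisson.

(** * Uniformly random masks *)

Section Masks.
Context {R : realType} {d m : nat}.

(** Exchanging the coordinates [j] and [k] permutes the masks. *)
Lemma card_mask_mem (j k : 'I_d) :
  \sum_(A : mask_set d m) (j \in val A)%:R =
  \sum_(A : mask_set d m) (k \in val A)%:R :> R.
Proof.
have swap_card (A : mask_set d m) : #|tperm j k @: val A| == m.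
  by rewrite card_imset ?(eqP (valP A)) //; exact: perm_inj.
pose swap (A : mask_set d m) : mask_set d m := 
    exist (fun B : {set 'I_d} => #|B| == m) _ (swap_card A).
have swapK : involutive swap.
  move=> A; apply: val_inj; rewrite /= -imset_comp -[RHS]imset_id.
  by apply: eq_imset => i /=; rewrite tpermK.
rewrite (reindex_inj (inv_inj swapK)); apply: eq_bigr => A _.
rewrite /= -{1}(tpermR j k) mem_imset //; exact: perm_inj.
Qed.

(** Double counting: the masks have [m] elements each, and every coordinate
    belongs to equally many of them. This is the unbiasedness of the
    sparsification under the stationary law. *)
Lemma sum_mask_unbiased (j : 'I_d) : (0 < m)%N ->
  \sum_(A : mask_set d m) (d%:R / m%:R * (j \in val A)%:R - 1) = 0 :> R.
Proof.
move=> m0; rewrite sumrB -mulr_sumr sumr_const.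
have : \sum_(k < d) \sum_(A : mask_set d m) (k \in val A)%:R
    = m%:R * #|{: mask_set d m}|%:R :> R.
  rewrite exchange_big /= mulr_natr -sumr_const; apply: eq_bigr => A _.
  have /eqP mA := valP A; rewrite -natr_sum -[in RHS]mA -sum1_card [in RHS]big_mkcond.
  by congr _%:R; apply: eq_bigr => k _; case: (k \in _).
under eq_bigr do rewrite (card_mask_mem _ j).
rewrite sumr_const card_ord => e.
have {e} -> : d%:R / m%:R * \sum_(A : mask_set d m) (j \in val A)%:R =
    m%:R^-1 * (m%:R * #|{: mask_set d m}|%:R) :> R.
  by rewrite -e -mulr_natl; ring.
by rewrite mulKf ?subrr // pnatr_eq0 -lt0n.
Qed.

End Masks.

(** * Pathwise estimates for one run of the method *)

Section Pathwise.
Context {R : realType} {d n : nat}.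
Variables (f : 'I_n -> 'rV[R]_d -> R) (Li : 'I_n -> R).
Variables (L delta sigma : R) (xstar : 'rV[R]_d).
Implicit Types (x y : 'rV[R]_d) (M : R) (b : 'I_n -> 'I_d -> R).

Hypothesis n_gt0 : (0 < n)%N.
Hypothesis df : forall i x, differentiable (f i) x.
Hypothesis lip_fi : forall i x y,
  nsq (grad (f i) x - grad (f i) y) <= Li i ^+ 2 * nsq (x - y).
Hypothesis L_gt0 : 0 < L.
Hypothesis L_avg : L ^+ 2 = n%:R^-1 * \sum_(i < n) Li i ^+ 2.
Hypothesis hetero : forall i x,
  nsq (grad (f i) x - grad (favg f) x) <=
    delta ^+ 2 * nsq (grad (favg f) x) + sigma ^+ 2.
Hypothesis xstar_min : forall y, favg f xstar <= favg f y.

Let G x := grad (favg f) x.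
Let A : R := delta ^+ 2 + 1.

(** By the bound on the heterogeneity, the mean of the squared gradients of
    the workers is at most [moment x]. *)
Definition moment x : R :=
  2 * (delta ^+ 2 + 1) * nsq (grad (favg f) x) + 2 * sigma ^+ 2.

(** The mean over the workers of their gradients rescaled coordinatewise by
    [b]. The update direction, the gradient of the mean function ([b = 1]) and
    the correction of the potential all have this form. *)
Definition wavg b x : 'rV[R]_d :=
  n%:R^-1 *: \sum_(i < n) \row_(j < d) (b i j * grad (f i) x 0 j).

Let A_ge1 : 1 <= A.
Proof. by rewrite /A lerDr sqr_ge0. Qed.

Let dF x : differentiable (favg f) x.
Proof. by apply: differentiable_favg. Qed.

Lemma lip_favg x y : nsq (G x - G y) <= L ^+ 2 * nsq (x - y).
Proof.
rewrite /G !grad_favg // -scalerBr -sumrB; apply: le_trans (nsq_avg_le _ n_gt0) _.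
rewrite L_avg -mulrA ler_pM2l ?invr_gt0 ?ltr0n // mulr_suml.
exact: ler_sum.
Qed.

Lemma moment_ge x : 2 * nsq (G x) <= moment x.
Proof.
have := nsq_ge0 (G x); have := sqr_ge0 delta; have := sqr_ge0 sigma.
by rewrite /moment /G; nra.
Qed.

Lemma moment_ge0 x : 0 <= moment x.
Proof. by apply: le_trans (moment_ge x); rewrite mulr_ge0 ?nsq_ge0. Qed.

Lemma avg_nsq_grad_le x :
  n%:R^-1 * \sum_(i < n) nsq (grad (f i) x) <= moment x.
Proof.
rewrite ler_pdivrMl ?ltr0n // mulr_natl -[in leRHS](card_ord n) -sumr_const.
apply: ler_sum => i _; rewrite -[grad (f i) x](subrK (G x)).
apply: le_trans (nsqD_le _ _) _; have := hetero i x.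
by rewrite /moment /G; lra.
Qed.

Lemma nsq_row_mul_le (c : 'I_d -> R) M (v : 'rV[R]_d) : (forall j, `|c j| <= M) ->
  nsq (\row_j (c j * v 0 j)) <= M ^+ 2 * nsq v.
Proof.
move=> cM; rewrite mulr_sumr; apply: ler_sum => j _; rewrite !mxE.
rewrite mulrACA -!expr2 ler_wpM2r ?sqr_ge0 // -real_normK ?num_real //.
by rewrite lerXn2r ?nnegrE // (le_trans _ (cM j)).
Qed.

Lemma nsq_wavg_le b M x : (forall i j, `|b i j| <= M) ->
  nsq (wavg b x) <= M ^+ 2 * moment x.
Proof.
move=> bM; apply: le_trans (nsq_avg_le _ n_gt0) _.
apply: le_trans (ler_wpM2l (sqr_ge0 M) (avg_nsq_grad_le x)).
rewrite mulrCA ler_pM2l ?invr_gt0 ?ltr0n // mulr_sumr; apply: ler_sum => i _.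
exact: nsq_row_mul_le.
Qed.

Lemma nsq_wavg_sub_le b M x y : (forall i j, `|b i j| <= M) ->
  nsq (wavg b x - wavg b y) <= M ^+ 2 * (L ^+ 2 * nsq (x - y)).
Proof.
move=> bM; rewrite /wavg -scalerBr -sumrB.
apply: le_trans (nsq_avg_le _ n_gt0) _.
have -> : M ^+ 2 * (L ^+ 2 * nsq (x - y)) =
    n%:R^-1 * (M ^+ 2 * (\sum_(i < n) Li i ^+ 2 * nsq (x - y))).
  by rewrite L_avg -mulr_suml; ring.
rewrite ler_pM2l ?invr_gt0 ?ltr0n // mulr_sumr.
apply: ler_sum => i _.
have -> : \row_j (b i j * grad (f i) x 0 j) - \row_j (b i j * grad (f i) y 0 j) =
    \row_j (b i j * (grad (f i) x - grad (f i) y) 0 j).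
  by apply/rowP => j; rewrite !mxE; ring.
apply: le_trans (nsq_row_mul_le _ (bM i)) _.
by rewrite ler_wpM2l ?sqr_ge0.
Qed.

Lemma dotp_wavgB b b' x u :
  dotp u (wavg (fun i j => b i j - b' i j) x) =
  dotp u (wavg b x) - dotp u (wavg b' x).
Proof.
rewrite -dotpNr -dotpDr /wavg -scalerBr -sumrB; congr (dotp _ (_ *: _)).
by apply: eq_bigr => i _; apply/rowP => j; rewrite !mxE; ring.
Qed.

Lemma wavg1 x : wavg (fun _ _ => 1) x = G x.
Proof.
rewrite /G grad_favg //; congr (_ *: _); apply: eq_bigr => i _.
by apply/rowP => j; rewrite !mxE mul1r.
Qed.

Variables (D gamma : R) (tau : nat).
Hypothesis D_ge1 : 1 <= D.
Hypothesis gamma_gt0 : 0 < gamma.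
Hypothesis tau_gt0 : (0 < tau)%N.

Let eta : R := gamma * L * tau%:R * D ^+ 2.
Hypothesis eta_small : eta * A <= 64^-1.

Let twelve_64 : 12 * 64^-1 <= 2^-1 :> R.
Proof. lra. Qed.

Let A_gt0 : 0 < A.
Proof. exact: lt_le_trans ltr01 A_ge1. Qed.

Let tau_ge1 : 1 <= tau%:R :> R.
Proof. by rewrite ler1n. Qed.

Let gL_gt0 : 0 < gamma * L.
Proof. exact: mulr_gt0. Qed.

Let eta_gt0 : 0 < eta.
Proof. by rewrite /eta !mulr_gt0 ?exprn_gt0 // ?ltr0n //; exact: lt_le_trans D_ge1. Qed.

Let eta_le : eta <= 64^-1.
Proof. by apply: le_trans eta_small; rewrite ler_peMr // ltW. Qed.

Let eta_le1 : eta <= 1.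
Proof. by apply: le_trans eta_le _; rewrite invf_le1 // ler1n. Qed.

Let D2_ge1 : 1 <= D ^+ 2.
Proof. by rewrite exprn_ege1. Qed.

Let gLtau_le_eta : gamma * L * tau%:R <= eta.
Proof. by rewrite /eta ler_peMr // mulr_ge0 // ltW. Qed.

Let gLD2_le_eta : gamma * L * D ^+ 2 <= eta.
Proof.
rewrite /eta [leRHS]mulrAC ler_peMr // mulr_ge0 //; first exact: ltW.
exact: sqr_ge0.
Qed.

Section OneStep.
Variables (x : 'rV[R]_d) (bq : 'I_n -> 'I_d -> R).
Hypothesis bqD : forall i j, `|bq i j| <= D.
Let y := x - gamma *: wavg bq x.

Lemma nsq_step_le : nsq (x - y) <= gamma ^+ 2 * D ^+ 2 * moment x.
Proof.
rewrite /y opprB addrC subrK nsqZ -mulrA ler_wpM2l ?sqr_ge0 //.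
exact: nsq_wavg_le.
Qed.

Let sq_gLD_le : L ^+ 2 * (gamma ^+ 2 * D ^+ 2) <= eta ^+ 2.
Proof.
have -> : eta ^+ 2 = L ^+ 2 * (gamma ^+ 2 * D ^+ 2) * (tau%:R ^+ 2 * D ^+ 2).
  by rewrite /eta; ring.
have h : 1 <= tau%:R ^+ 2 * D ^+ 2 :> R by apply: mulr_ege1; rewrite // exprn_ege1.
by rewrite -[leLHS]mulr1; apply: ler_wpM2l h;
  exact: (mulr_ge0 (sqr_ge0 _) (mulr_ge0 (sqr_ge0 _) (sqr_ge0 _))).
Qed.

Lemma nsq_grad_step_le : nsq (G y) <= 2 * moment x.
Proof.
rewrite -[G y](subrK (G x)); apply: le_trans (nsqD_le _ _) _.
have h1 : nsq (G y - G x) <= eta ^+ 2 * moment x.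
  rewrite nsq_sub_sym; apply: le_trans (lip_favg x y) _.
  apply: (@le_trans _ _ (L ^+ 2 * (gamma ^+ 2 * D ^+ 2 * moment x))).
    by rewrite ler_wpM2l ?sqr_ge0 // nsq_step_le.
  by rewrite mulrA ler_wpM2r ?moment_ge0.
have h2 : eta ^+ 2 <= 2^-1 by have := eta_gt0; have := eta_le; nra.
have := moment_ge x; have := moment_ge0 x; nra.
Qed.

(** Both arguments of the pairing are Lipschitz and of size [sqrt (moment x)],
    up to the factor [2 tau D] that bounds [b], and one step moves the iterate
    by at most [gamma * D * sqrt (moment x)]. *)
Lemma corrector_step_le b : (forall i j, `|b i j| <= 2 * tau%:R * D) ->
  dotp (G x) (wavg b x) - dotp (G y) (wavg b y) <= 5 * eta * moment x.
Proof.
move=> bM; set M := 2 * tau%:R * D in bM.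
have -> : dotp (G x) (wavg b x) - dotp (G y) (wavg b y) =
    dotp (G x - G y) (wavg b x) + dotp (G y) (wavg b x - wavg b y).
  by rewrite dotpDl dotpDr dotpNl dotpNr addrA subrK.
have t0 : 0 < tau%:R :> R by rewrite ltr0n.
(* The weights of the two applications of AM-GM, chosen so that both of their
   terms become multiples of [eta * moment x]. *)
have k1 : 0 < 2 * tau%:R / (L * gamma) by rewrite divr_gt0 ?mulr_gt0.
have k2 : 0 < 2 * eta by rewrite mulr_gt0.
have step2 : L ^+ 2 * nsq (x - y) <= L ^+ 2 * (gamma ^+ 2 * D ^+ 2 * moment x).
  by rewrite ler_wpM2l ?sqr_ge0 // nsq_step_le.
have p1 : dotp (G x - G y) (wavg b x) <= 2 * eta * moment x.
  apply: le_trans (dotp_young _ _ k1) _.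
  have h1 : 2 * tau%:R / (L * gamma) * nsq (G x - G y) <= 2 * eta * moment x.
    have -> : 2 * eta * moment x = 2 * tau%:R / (L * gamma) *
        (L ^+ 2 * (gamma ^+ 2 * D ^+ 2 * moment x)).
      by rewrite /eta; field; rewrite !gt_eqF.
    by rewrite ler_pM2l //; apply: le_trans (lip_favg x y) step2.
  have h2 : nsq (wavg b x) / (2 * tau%:R / (L * gamma)) <= 2 * eta * moment x.
    rewrite ler_pdivrMr //; apply: le_trans (nsq_wavg_le x bM) _.
    rewrite le_eqVlt; apply/orP; left; apply/eqP; rewrite /M /eta.
    by field; rewrite !gt_eqF.
  lra.
have p2 : dotp (G y) (wavg b x - wavg b y) <= 3 * eta * moment x.
  apply: le_trans (dotp_young _ _ k2) _.
  have h1 : 2 * eta * nsq (G y) <= 2 * eta * (2 * moment x).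
    by rewrite ler_pM2l // nsq_grad_step_le.
  have h2 : nsq (wavg b x - wavg b y) / (2 * eta) <= 2 * eta * moment x.
    rewrite ler_pdivrMr //; apply: le_trans (nsq_wavg_sub_le x y bM) _.
    apply: (@le_trans _ _ (M ^+ 2 * (L ^+ 2 * (gamma ^+ 2 * D ^+ 2 * moment x)))).
      by rewrite ler_wpM2l ?sqr_ge0.
    by rewrite le_eqVlt; apply/orP; left; apply/eqP; rewrite /M /eta; ring.
  lra.
lra.
Qed.

(** With [b] and [b'] the corrector before and after averaging over the next
    mask, [b - b' = bq - 1] turns the noise of the update direction into a
    difference of corrections. Moving the second correction from [x] to [y]
    leaves an error that, like the quadratic term of the descent, is of order
    [gamma * eta * moment x]. *)
Lemma potential_step b b' :
  (forall i j, `|b' i j| <= 2 * tau%:R * D) ->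
  (forall i j, b i j - b' i j = bq i j - 1) ->
  favg f y - gamma * dotp (G y) (wavg b' y) <=
  favg f x - gamma * dotp (G x) (wavg b x)
    - gamma / 2 * nsq (G x) + 12 * gamma * eta * sigma ^+ 2.
Proof.
move=> b'M bb'.
have e : dotp (G x) (wavg bq x) =
    nsq (G x) + dotp (G x) (wavg b x) - dotp (G x) (wavg b' x).
  have : dotp (G x) (wavg (fun i j => b i j - b' i j) x) =
      dotp (G x) (wavg (fun i j => bq i j - 1) x).
    by congr (dotp _ (wavg _ _)); apply/funext => i; apply/funext => j.
  by rewrite !dotp_wavgB wavg1 -/(nsq _); lra.
have h1 : favg f y <=
    favg f x - gamma * dotp (G x) (wavg bq x) + gamma * eta * moment x.
  apply: le_trans (descent dF L_gt0 lip_favg x _) _.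
  rewrite dotpNr dotpZr -/(G x) lerD2l -scaleNr nsqZ sqrrN.
  have := nsq_wavg_le x bqD => h.
  apply: (@le_trans _ _ (L * (gamma ^+ 2 * (D ^+ 2 * moment x)))).
    by rewrite !ler_pM2l // exprn_gt0.
  have -> : L * (gamma ^+ 2 * (D ^+ 2 * moment x)) =
      gamma * (gamma * L * D ^+ 2) * moment x by ring.
  by rewrite ler_wpM2r ?moment_ge0 // ler_pM2l.
have h2 : gamma * (dotp (G x) (wavg b' x) - dotp (G y) (wavg b' y)) <=
    gamma * (5 * eta * moment x).
  by rewrite ler_pM2l // corrector_step_le.
have h3 : gamma * (6 * eta * moment x) <=
    gamma * (2^-1 * nsq (G x) + 12 * eta * sigma ^+ 2).
  rewrite ler_pM2l //.
  have -> : 6 * eta * moment x = 12 * (eta * A * nsq (G x)) + 12 * eta * sigma ^+ 2.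
    by rewrite /moment /A; ring.
  rewrite lerD2r; apply: (@le_trans _ _ (12 * (64^-1 * nsq (G x)))).
    by rewrite ler_pM2l // ler_wpM2r ?nsq_ge0.
  by rewrite mulrA ler_wpM2r ?nsq_ge0.
move: h1 h2 h3; rewrite e.
move: (favg f y) (favg f x) (moment x) (nsq (G x)) => fy fx mx Gx.
move: (dotp _ (wavg b x)) (dotp _ (wavg b' x)) (dotp _ (wavg b' y)) => p q r.
lra.
Qed.

End OneStep.

Lemma nsq_grad_favg_le x : nsq (G x) <= 4 * L * (favg f x - favg f xstar).
Proof. exact: (nsq_grad_le dF L_gt0 lip_favg). Qed.

(** The correction is of order [gamma * tau * D * sqrt (nsq (grad f x) *
    moment x)], which for small [eta] is a fraction of the gap and a noise
    term. *)
Lemma corrector_le b x : (forall i j, `|b i j| <= 2 * tau%:R * D) ->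
  `|gamma * dotp (G x) (wavg b x)| <=
  (favg f x - favg f xstar) / 4 + 64 * gamma * tau%:R * eta * sigma ^+ 2.
Proof.
move=> bM; rewrite normrM gtr0_norm //.
have t0 : 0 < tau%:R :> R by rewrite ltr0n.
(* This weight makes the gradient term a fraction of the gap. *)
have k0 : 0 < (16 * gamma * L)^-1 by rewrite invr_gt0 -mulrA mulr_gt0.
apply: (@le_trans _ _ (gamma *
    (((16 * gamma * L)^-1 * nsq (G x) + nsq (wavg b x) / (16 * gamma * L)^-1) / 2))).
  by rewrite ler_pM2l // normr_dotp_young.
set De := favg f x - favg f xstar.
have De0 : 0 <= De by rewrite subr_ge0.
have hG := nsq_grad_favg_le x; rewrite -/De in hG.
have h1 : gamma * ((16 * gamma * L)^-1 * nsq (G x)) <= De / 4.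
  apply: (@le_trans _ _ (gamma * ((16 * gamma * L)^-1 * (4 * L * De)))).
    by rewrite !ler_pM2l.
  by rewrite le_eqVlt; apply/orP; left; apply/eqP; field; rewrite !gt_eqF.
have h2 : gamma * (nsq (wavg b x) / (16 * gamma * L)^-1) <=
    De / 4 + 2 * (64 * gamma * tau%:R * eta * sigma ^+ 2).
  apply: (@le_trans _ _ (gamma * ((2 * tau%:R * D) ^+ 2 * moment x / (16 * gamma * L)^-1))).
    rewrite ler_pM2l // ler_wpM2r ?nsq_wavg_le //.
    by rewrite invr_ge0 ltW.
  have -> : gamma * ((2 * tau%:R * D) ^+ 2 * moment x / (16 * gamma * L)^-1) =
      128 * (gamma * tau%:R * (eta * A)) * nsq (G x)
        + 2 * (64 * gamma * tau%:R * eta * sigma ^+ 2).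
    by rewrite /moment invrK /eta /A; ring.
  rewrite lerD2r.
  apply: (@le_trans _ _ (128 * (gamma * tau%:R * (eta * A)) * (4 * L * De))).
    apply: ler_wpM2l => //; apply: mulr_ge0 => //; apply: ltW.
    by rewrite mulr_gt0 ?(mulr_gt0 gamma_gt0) // (mulr_gt0 eta_gt0).
  have -> : 128 * (gamma * tau%:R * (eta * A)) * (4 * L * De) =
      512 * (gamma * L * tau%:R) * (eta * A) * De by ring.
  rewrite mulrC; rewrite ler_wpM2l //.
  have p0 : 0 <= gamma * L * tau%:R by rewrite mulr_ge0 // ltW.
  have q0 : gamma * L * tau%:R <= 64^-1 by apply: le_trans gLtau_le_eta _.
  have := eta_small; have : 0 <= eta * A by rewrite ltW // (mulr_gt0 eta_gt0).
  nra.
lra.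
Qed.

(** In [tau] steps the iterate moves by at most [gamma * tau * D] times the
    root of the largest [moment], and [gamma * L * tau * D] is small. So the
    gradients before time [tau] are controlled by the one at time [tau]. *)
Lemma early_gradients_le (x : nat -> 'rV[R]_d) (g : nat -> 'rV[R]_d) :
  (forall t, x t.+1 = x t - gamma *: g t) ->
  (forall t, nsq (g t) <= D ^+ 2 * moment (x t)) ->
  \sum_(t < tau) nsq (G (x t)) <=
  tau%:R * (3 * nsq (G (x tau)) + 8 * eta * sigma ^+ 2).
Proof.
move=> xS gM.
have t0 : 0 < tau%:R :> R by rewrite ltr0n.
set Sg := \sum_(t < tau) nsq (G (x t)).
pose SB := \sum_(t < tau) moment (x t).
have SB0 : 0 <= SB by apply: sumr_ge0 => t _; exact: moment_ge0.
(* [SB] occurs on both sides of the estimate below, where it is absorbed because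
   [A * rho] is small. *)
pose rho := (gamma * L * tau%:R * D) ^+ 2.
have rho_le : rho <= eta ^+ 2.
  have -> : eta ^+ 2 = rho * D ^+ 2 by rewrite /rho /eta; ring.
  by rewrite ler_peMr // sqr_ge0.
have rho0 : 0 <= rho by rewrite sqr_ge0.
(* The zero terms extend the sum of the increments to a fixed index range. *)
have disp t : (t < tau)%N -> nsq (x t - x tau) <= gamma ^+ 2 * tau%:R * D ^+ 2 * SB.
  move=> ttau.
  have -> : x t - x tau = gamma *: \sum_(s < tau) (if (t <= s)%N then g s else 0).
    rewrite -(big_mkord xpredT (fun s => if (t <= s)%N then g s else 0)).
    rewrite (big_cat_nat (n := t)) //=; last exact: ltnW.
    rewrite big_nat_cond big1 ?add0r; last first.
      by move=> s; rewrite andbT => /= st; rewrite leqNgt st.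
    rewrite -opprB -(telescope_sumr x); last exact: ltnW.
    rewrite -sumrN scaler_sumr big_nat [RHS]big_nat.
    apply: eq_bigr => s /andP[ts _]; rewrite ts xS; apply/rowP => j.
    by rewrite !mxE; ring.
  have -> : gamma ^+ 2 * tau%:R * D ^+ 2 * SB =
      gamma ^+ 2 * (tau%:R * (D ^+ 2 * SB)) by ring.
  rewrite nsqZ ler_wpM2l ?sqr_ge0 //.
  apply: le_trans (nsq_sum_le _) _; rewrite card_ord ler_pM2l // mulr_sumr.
  apply: ler_sum => s _; case: ifP => _ //.
  rewrite /nsq /dotp big1 => [|j _]; last by rewrite mxE mul0r.
  exact: (mulr_ge0 (sqr_ge0 D) (moment_ge0 _)).
have near t : (t < tau)%N -> nsq (G (x t)) <=
    2 * nsq (G (x tau)) + 2 * (rho / tau%:R * SB).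
  move=> ttau; rewrite -[G (x t)](subrK (G (x tau))).
  apply: le_trans (nsqD_le _ _) _; rewrite addrC lerD2l ler_pM2l //.
  apply: le_trans (lip_favg _ _) _.
  apply: (@le_trans _ _ (L ^+ 2 * (gamma ^+ 2 * tau%:R * D ^+ 2 * SB))).
    by rewrite ler_wpM2l ?sqr_ge0 // disp.
  rewrite le_eqVlt; apply/orP; left; apply/eqP; rewrite /rho.
  by field; rewrite gt_eqF.
have Sg_le : Sg <= tau%:R * (2 * nsq (G (x tau))) + 2 * rho * SB.
  have -> : tau%:R * (2 * nsq (G (x tau))) + 2 * rho * SB =
      \sum_(t < tau) (2 * nsq (G (x tau)) + 2 * (rho / tau%:R * SB)).
    by rewrite sumr_const card_ord -mulr_natl; field; rewrite gt_eqF.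
  by apply: ler_sum => t _; exact: near.
have SBE : SB = 2 * A * Sg + tau%:R * (2 * sigma ^+ 2).
  rewrite /SB /moment big_split /= -mulr_sumr sumr_const card_ord.
  by rewrite -[_ *+ tau]mulr_natl.
have A0 : 0 <= A by exact: ltW.
have Arho : A * rho <= 64^-1 * eta.
  apply: (@le_trans _ _ (A * eta ^+ 2)); first by rewrite ler_wpM2l.
  by rewrite expr2 mulrA (mulrC A) ler_wpM2r // ltW.
have SB_le : SB <= 2 * (tau%:R * (4 * A * nsq (G (x tau)) + 2 * sigma ^+ 2)).
  have h : 2 * A * Sg <= 2 * A * (tau%:R * (2 * nsq (G (x tau)))) + 4 * (A * rho) * SB.
    have -> : 2 * A * (tau%:R * (2 * nsq (G (x tau)))) + 4 * (A * rho) * SB =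
      2 * A * (tau%:R * (2 * nsq (G (x tau))) + 2 * rho * SB) by ring.
    by rewrite ler_wpM2l // mulr_ge0.
  have h2 : 4 * (A * rho) * SB <= 2^-1 * SB.
    by rewrite ler_wpM2r //; have := eta_le; lra.
  move: SBE; lra.
apply: le_trans Sg_le _.
have h3 : 2 * rho * SB <=
   2 * rho * (2 * (tau%:R * (4 * A * nsq (G (x tau)) + 2 * sigma ^+ 2))).
  by rewrite ler_wpM2l // mulr_ge0.
have h4 : rho * sigma ^+ 2 <= eta * sigma ^+ 2.
  rewrite ler_wpM2r ?sqr_ge0 //; apply: le_trans rho_le _.
  by rewrite expr2 ler_piMl ?eta_le1 // ltW.
have h5 : A * rho * nsq (G (x tau)) <= 64^-1 * nsq (G (x tau)).
  by rewrite ler_wpM2r ?nsq_ge0 //; have := eta_le; lra.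
apply: (@le_trans _ _ (tau%:R * (2 * nsq (G (x tau)) +
    (16 * (A * rho * nsq (G (x tau))) + 8 * (rho * sigma ^+ 2))))).
  by move: h3; lra.
rewrite ler_pM2l //.
have := nsq_ge0 (G (x tau)); lra.
Qed.

End Pathwise.

(** * Weighted means on a finite set *)

Section WeightedMean.
Context {R : realType} {W : finType}.
Variable q : W -> R.
Hypothesis q_ge0 : forall h, 0 <= q h.
Hypothesis q_sum1 : \sum_h q h = 1.
Implicit Types X Y : W -> R.

Definition wmean X : R := \sum_h q h * X h.

Lemma wmeanD X Y : wmean (fun h => X h + Y h) = wmean X + wmean Y.
Proof. by rewrite -big_split; apply: eq_bigr => h _; rewrite mulrDr. Qed.

Lemma wmeanZ c X : wmean (fun h => c * X h) = c * wmean X.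
Proof. by rewrite mulr_sumr; apply: eq_bigr => h _; rewrite mulrCA. Qed.

Lemma wmeanB X Y : wmean (fun h => X h - Y h) = wmean X - wmean Y.
Proof. by rewrite -sumrB; apply: eq_bigr => h _; rewrite mulrBr. Qed.

Lemma wmean_cst c : wmean (fun=> c) = c.
Proof. by rewrite /wmean -mulr_suml q_sum1 mul1r. Qed.

Lemma wmean_sum (I : Type) (r : seq I) (X : I -> W -> R) :
  wmean (fun h => \sum_(i <- r) X i h) = \sum_(i <- r) wmean (X i).
Proof.
by rewrite exchange_big; apply: eq_bigr => h _; rewrite mulr_sumr.
Qed.

Lemma le_wmean X Y : (forall h, X h <= Y h) -> wmean X <= wmean Y.
Proof. by move=> XY; apply: ler_sum => h _; rewrite ler_wpM2l. Qed.

Lemma wmean_ge0 X : (forall h, 0 <= X h) -> 0 <= wmean X.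
Proof. by move=> X0; apply: sumr_ge0 => h _; rewrite mulr_ge0. Qed.

End WeightedMean.

(** * Expectations of finitely valued functions *)

Section FinitelyValued.
Context {R : realType} {disp : measure_display} {Omega : measurableType disp}.
Variable P : probability Omega R.

(** All random variables of the problem are functions of finitely many masks,
    and of a random time, so that every expectation is a finite sum. *)
Lemma expectation_finite (U : finType) (Z : Omega -> U) (phi : U -> R) :
  (forall u, measurable [set w | Z w = u]) ->
  'E_P[fun w => phi (Z w)]%E =
  (wmean (fun u => fine (P [set w | Z w = u])) phi)%:E.
Proof.
move=> mZ; rewrite unlock.
have -> : (fun w => (phi (Z w))%:E) =
    (fun w => \sum_u ((phi u)%:E * (\1_[set w | Z w = u] w)%:E)%E)%E.
  apply/funext => w; rewrite (bigD1 (Z w)) //= indicE mem_set // mule1.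
  rewrite big1 ?adde0 // => u uZ; rewrite indicE memNset ?mule0 //.
  by move=> /= e; rewrite e eqxx in uZ.
have iZ u : P.-integrable setT (fun w => (\1_[set w | Z w = u] w)%:E).
  exact: integrable_indic.
rewrite integral_sum // => [|u]; last exact: integrableZl.
rewrite /wmean -sumEFin; apply: eq_bigr => u _.
rewrite integralZl // integral_indic // setIT EFinM muleC fineK //.
exact: fin_num_measure.
Qed.

Lemma sum_fine_probability1 (U : finType) (Z : Omega -> U) :
  (forall u, measurable [set w | Z w = u]) ->
  \sum_u fine (P [set w | Z w = u]) = 1.
Proof.
move=> mZ; have := expectation_finite (fun=> 1) mZ.
rewrite (expectation_cst P 1) => -[->].
by apply: eq_bigr => u _; rewrite mulr1.
Qed.

End FinitelyValued.

(** * Trajectories of the masks *)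

Section Trajectories.
Context {R : realType} {disp : measure_display} {Omega : measurableType disp}.
Variable P : probability Omega R.
Context {n : nat} {S : finType}.
Variable nu : 'I_n -> nat -> Omega -> S.
Hypothesis mnu : measurable_process nu.
Variable N : nat.

Definition traj : finType := {ffun 'I_n * 'I_N.+1 -> S}.
Definition traj_of (w : Omega) : traj := [ffun p : 'I_n * 'I_N.+1 => nu p.1 p.2 w].
Definition traj_at (i : 'I_n) (t : nat) (h : traj) : S := h (i, inord t).
Definition traj_law (h : traj) : R := fine (P [set w | traj_of w = h]).

Lemma traj_ofE i t w : (t <= N)%N -> traj_at i t (traj_of w) = nu i t w.
Proof. by move=> tN; rewrite /traj_at ffunE /= inordK. Qed.

Lemma measurable_history t (g : 'I_n -> nat -> S) : measurable (history nu t g).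
Proof.
have -> : history nu t g = \bigcap_(p in [set: 'I_n * 'I_t.+1])
    [set w | nu p.1 p.2 w = g p.1 p.2].
  apply/seteqP; split => w /= H.
    by move=> [i s] _ /=; apply: H; rewrite -ltnS.
  by move=> i s st; exact: (H (i, Ordinal (st : (s < t.+1)%N))).
by apply: fin_bigcap_measurable => // p _; exact: mnu.
Qed.

Lemma traj_of_eq h :
  [set w | traj_of w = h] = history nu N (fun i s => traj_at i s h).
Proof.
apply/seteqP; split => w /= H.
  by move=> i s sN; rewrite -H traj_ofE.
apply/ffunP => -[i s]; rewrite ffunE /= (H i s (leq_ord s)).
by rewrite /traj_at inord_val.
Qed.

Lemma measurable_traj_of h : measurable [set w | traj_of w = h].
Proof. by rewrite traj_of_eq; exact: measurable_history. Qed.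

Lemma traj_law_ge0 h : 0 <= traj_law h.
Proof. by rewrite fine_ge0. Qed.

Lemma traj_law_sum1 : \sum_h traj_law h = 1.
Proof. exact: (sum_fine_probability1 P measurable_traj_of). Qed.

(** Freezing a trajectory at time [t] encodes its history up to [t] within the
    same finite type. *)
Definition stop t (h : traj) : traj :=
  [ffun p : 'I_n * 'I_N.+1 => h (p.1, inord (minn p.2 t))].

Lemma stop_at i s t h : (s <= t)%N -> (s <= N)%N ->
  traj_at i s (stop t h) = traj_at i s h.
Proof. by move=> st sN; rewrite /traj_at ffunE /= inordK // (minn_idPl st). Qed.

Lemma stop_traj_of_eq t u : (t <= N)%N -> stop t u = u ->
  [set w | stop t (traj_of w) = u] = history nu t (fun i s => traj_at i s u).
Proof.
move=> tN su; apply/seteqP; split => w /= H.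
  move=> i s st; have sN := leq_trans st tN.
  by rewrite -H stop_at // traj_ofE.
rewrite -su; apply/ffunP => -[i s]; rewrite !ffunE /=.
have mt : (minn s t <= t)%N by rewrite geq_minr.
have mN : (minn s t < N.+1)%N by rewrite ltnS (leq_trans mt).
by rewrite inordK // H.
Qed.

Lemma measurable_stop_traj_of t u : measurable [set w | stop t (traj_of w) = u].
Proof.
have -> : [set w | stop t (traj_of w) = u] =
    \big[setU/set0]_(h : traj | stop t h == u) [set w | traj_of w = h].
  rewrite -bigcup_seq_cond; apply/seteqP; split => w /=.
    by move=> H; exists (traj_of w) => //=; rewrite mem_index_enum H eqxx.
  by move=> [h /= /andP[_ /eqP <-] ->].
by apply: bigsetU_measurable => h _; exact: measurable_traj_of.
Qed.

(** Both sides are functions of the trajectory frozen at time [t] and of the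
    next state of the [i]-th chain, and the Markov property gives the joint
    law of that pair. *)
Lemma traj_markov i (K : S -> S -> R) : markov_chain P nu i K ->
  forall t (X : traj -> R) (b : S -> R), (t < N)%N ->
  (forall h h', (forall i s, (s <= t)%N -> traj_at i s h = traj_at i s h') ->
     X h = X h') ->
  wmean traj_law (fun h => X h * b (traj_at i t.+1 h)) =
  wmean traj_law (fun h => X h * kop K b (traj_at i t h)).
Proof.
move=> mK t X b tN Xadapt; have tN' := ltnW tN.
have Xstop h : X (stop t h) = X h.
  by apply: Xadapt => j s st; apply: stop_at => //; exact: leq_trans tN'.
pose Z w := (stop t (traj_of w), nu i t.+1 w).
have ZE u s : [set w | Z w = (u, s)] =
    [set w | stop t (traj_of w) = u] `&` [set w | nu i t.+1 w = s].
  by apply/seteqP; split => w /=; [case=> -> ->|case; rewrite /Z => -> ->].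
have mZ z : measurable [set w | Z w = z].
  case: z => u s; rewrite ZE; apply: measurableI; last exact: mnu.
  exact: measurable_stop_traj_of.
pose r u := fine (P [set w | stop t (traj_of w) = u]).
have PZ u s : fine (P [set w | Z w = (u, s)]) = r u * K (traj_at i t u) s.
  rewrite /r ZE; have [su|su] := eqVneq (stop t u) u.
    by rewrite !stop_traj_of_eq // mK fineM // fin_num_measure //;
      exact: measurable_history.
  (* A trajectory that is not frozen at time [t] is never attained. *)
  have -> : [set w | stop t (traj_of w) = u] = set0.
    apply/seteqP; split => w //= H; move: su; rewrite -H; case/eqP.
    have mN (s' : 'I_N.+1) : (minn s' t < N.+1)%N.
      by rewrite ltnS (leq_trans (geq_minr _ _)).
    apply/ffunP => -[j s']; rewrite !ffunE /=.
    by rewrite (inordK (mN s')) -minnA minnn (inordK (mN s')).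
  by rewrite set0I measure0 /= mul0r.
have lhs := expectation_finite P (fun h => X h * b (traj_at i t.+1 h))
  measurable_traj_of.
have rhs := expectation_finite P (fun h => X h * kop K b (traj_at i t h))
  measurable_traj_of.
apply: EFin_inj; rewrite -[LHS]lhs -[RHS]rhs.
have -> : (fun w => X (traj_of w) * b (traj_at i t.+1 (traj_of w))) =
    (fun w => (fun z => X z.1 * b z.2) (Z w)).
  by apply/funext => w /=; rewrite Xstop traj_ofE.
have -> : (fun w => X (traj_of w) * kop K b (traj_at i t (traj_of w))) =
    (fun w => (fun u => X u * kop K b (traj_at i t u)) (stop t (traj_of w))).
  by apply/funext => w /=; rewrite Xstop stop_at.
rewrite (expectation_finite P (fun z => X z.1 * b z.2) mZ).
rewrite (expectation_finite P (fun u => X u * kop K b (traj_at i t u))); last first.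
  exact: measurable_stop_traj_of.
congr _%:E; rewrite /wmean -/(r _).
transitivity (\sum_u \sum_s fine (P [set w | Z w = (u, s)]) * (X u * b s)).
  by rewrite pair_bigA; apply: eq_bigr => -[u s] _.
apply: eq_bigr => u _; rewrite /kop mulr_sumr mulr_sumr.
by apply: eq_bigr => s _; rewrite PZ /r; ring.
Qed.

Lemma expectation_traj (phi : traj -> R) :
  'E_P[fun w => phi (traj_of w)]%E = (wmean traj_law phi)%:E.
Proof. exact: expectation_finite measurable_traj_of. Qed.

Lemma expectation_uniform_index (J : Omega -> 'I_N.+1) (phi : nat -> traj -> R) :
  uniform_index P nu J ->
  'E_P[fun w => phi (J w) (traj_of w)]%E =
  (N.+1%:R^-1 * \sum_(k < N.+1) wmean traj_law (phi k))%:E.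
Proof.
case=> mJ PJ indJ; pose Z w := (J w, traj_of w).
have ZE k h : [set w | Z w = (k, h)] =
    [set w | J w = k] `&` history nu N (fun i s => traj_at i s h).
  rewrite -traj_of_eq.
  by apply/seteqP; split => w /=; [case=> -> ->|case; rewrite /Z => -> ->].
have mZ z : measurable [set w | Z w = z].
  by case: z => k h; rewrite ZE; apply: measurableI => //; exact: measurable_history.
rewrite (expectation_finite P (fun z : 'I_N.+1 * traj => phi z.1 z.2) mZ).
congr _%:E; rewrite /wmean.
transitivity (\sum_k \sum_h fine (P [set w | Z w = (k, h)]) * phi k h).
  by rewrite pair_bigA; apply: eq_bigr => -[k h] _.
rewrite mulr_sumr; apply: eq_bigr => k _; rewrite mulr_sumr; apply: eq_bigr => h _.
rewrite ZE indJ PJ -traj_of_eq fineM ?fin_num_measure //=; first by rewrite mulrA.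
exact: measurable_traj_of.
Qed.

End Trajectories.

(** * Recursions for a potential that stays close to the gap *)

Section LyapunovRecursion.
Context {R : realType}.
Variables (potential gap sqgrad : nat -> R) (gamma L v : R) (tau N : nat).
Hypothesis gamma_gt0 : 0 < gamma.
Hypothesis tau_gt0 : (0 < tau)%N.
Hypothesis v_ge0 : 0 <= v.
Hypothesis gLtau_le : gamma * L * tau%:R <= 64^-1.
Hypothesis gap_ge0 : forall t, 0 <= gap t.
Hypothesis sqgrad_le : forall t, sqgrad t <= 4 * L * gap t.
Hypothesis potential_close : forall t,
  `|potential t - gap t| <= gap t / 4 + 64 * (gamma * tau%:R) * v.
Hypothesis potential_decrease : forall t, (0 < t)%N -> (t <= N)%N ->
  potential t.+1 <= potential t - gamma / 2 * sqgrad t + 12 * (gamma * v).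

Let potential_le t : potential t <= 5 / 4 * gap t + 64 * (gamma * tau%:R) * v.
Proof. by have := potential_close t; rewrite ler_norml => /andP[_]; lra. Qed.

Let potential_ge t : 3 / 4 * gap t <= potential t + 64 * (gamma * tau%:R) * v.
Proof. by have := potential_close t; rewrite ler_norml => /andP[+ _]; lra. Qed.

(* Telescoping the decrease of the potential from time [tau] on. *)
Let late_sum k : (tau + k <= N.+1)%N ->
  gamma / 2 * (\sum_(tau <= t < tau + k) sqgrad t) <=
  potential tau - potential (tau + k) + k%:R * (12 * (gamma * v)).
Proof.
elim: k => [|k IH] kN; first by rewrite addn0 big_geq // subrr mul0r mulr0 addr0.
have kN' : (tau + k <= N)%N by move: kN; rewrite addnS ltnS.
rewrite addnS big_nat_recr ?leq_addr //= mulrDr -natr1.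
have := potential_decrease (leq_trans tau_gt0 (leq_addr k tau)) kN'.
have := IH (leqW kN').
move: (potential _) (potential _) (potential _) (gamma / 2 * _) (gamma / 2 * _).
move: (gamma * v) => gv p0 p1 p2 s1 s2; lra.
Qed.

Hypothesis early_sum :
  \sum_(t < tau) sqgrad t <= tau%:R * (3 * sqgrad tau + 8 * v).

(** The potential at [tau] and minus the potential at [T + 1] are bounded by
    the gap at [tau] and noise. The times before [tau] cost [tau * L * gap
    tau], which is at most [gap tau / gamma] as [gamma * L * tau] is small. *)
Lemma sum_sqgrad_le T : (tau < T)%N -> (T <= N)%N ->
  \sum_(t < T.+1) sqgrad t <= 300 * (gap tau / gamma + T%:R * v).
Proof.
move=> tauT TN; have tauT1 : (tau <= T.+1)%N by rewrite ltnW // ltnS ltnW.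
have t0 : 0 < tau%:R :> R by rewrite ltr0n.
have -> : \sum_(t < T.+1) sqgrad t =
    \sum_(t < tau) sqgrad t + \sum_(tau <= t < T.+1) sqgrad t.
  by rewrite -(big_mkord xpredT sqgrad) (big_cat_nat (n := tau)) //= big_mkord.
have := @late_sum (T.+1 - tau)%N; rewrite subnKC // => /(_ TN).
set La := \sum_(tau <= t < T.+1) _ => hLa.
have tT : tau%:R <= T%:R :> R by rewrite ler_nat ltnW.
have cardT : (T.+1 - tau)%:R <= 2 * (T%:R - tau%:R) :> R.
  rewrite natrB // -natr1.
  have : tau%:R + 1 <= T%:R :> R by rewrite natr1 ler_nat.
  by lra.
have tv : tau%:R * v <= T%:R * v by rewrite ler_wpM2r.
have tv0 : 0 <= T%:R * v by rewrite mulr_ge0.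
have hLa2 : La <= 5 / 2 * (gap tau / gamma) + 256 * (T%:R * v).
  rewrite -(ler_pM2l (_ : 0 < gamma / 2)); last by rewrite divr_gt0.
  apply: le_trans hLa _.
  have -> : gamma / 2 * (5 / 2 * (gap tau / gamma) + 256 * (T%:R * v)) =
      5 / 4 * gap tau + gamma * (128 * (T%:R * v)).
    by field; rewrite gt_eqF.
  have Lv : (T.+1 - tau)%:R * (12 * (gamma * v)) <=
      gamma * (24 * (T%:R * v - tau%:R * v)).
    have -> : gamma * (24 * (T%:R * v - tau%:R * v)) =
        2 * (T%:R - tau%:R) * (12 * (gamma * v)) by ring.
    by rewrite ler_wpM2r // mulr_ge0 // mulr_ge0 // ltW.
  have h4 : gamma * (128 * (tau%:R * v) + 24 * (T%:R * v - tau%:R * v)) <=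
      gamma * (128 * (T%:R * v)).
    by rewrite ler_pM2l //; move: tv; lra.
  have := potential_le tau; have := potential_ge T.+1; have := gap_ge0 T.+1.
  by move: Lv h4; lra.
have hE : tau%:R * (3 * sqgrad tau) <= gap tau / gamma.
  rewrite ler_pdivlMr //.
  apply: (@le_trans _ _ (tau%:R * (3 * (4 * L * gap tau)) * gamma)).
    by rewrite ler_pM2r // ler_pM2l // ler_pM2l.
  have -> : tau%:R * (3 * (4 * L * gap tau)) * gamma =
    12 * (gamma * L * tau%:R) * gap tau by ring.
  by rewrite ler_piMl //; move: gLtau_le; lra.
have g0 : 0 <= gap tau / gamma by rewrite divr_ge0 // ltW.
move: early_sum; rewrite mulrDr.
have -> : tau%:R * (8 * v) = 8 * (tau%:R * v) by ring.
move: hE hLa2 tv tv0 g0; lra.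
Qed.

(** Under the PL condition the decrease of the potential is proportional to
    the gap, hence to the potential up to noise, and the potential contracts
    towards the noise level [w]. *)
Lemma gap_le_PL T mu : 0 < mu -> mu <= 2 * L ->
  (forall t, 2 * mu * gap t <= sqgrad t) -> (tau < T)%N -> (T <= N)%N ->
  gap T <= 300 * ((1 - mu * gamma / 12) ^+ (T - tau) * gap tau + v / mu).
Proof.
move=> mu0 muL PL tauT TN.
have t0 : 0 < tau%:R :> R by rewrite ltr0n.
pose al := mu * gamma / 12.
have al0 : 0 < al by rewrite divr_gt0 // mulr_gt0.
have gtm : gamma * tau%:R * mu <= 32^-1.
  apply: (@le_trans _ _ (gamma * tau%:R * (2 * L))).
    by rewrite ler_pM2l // mulr_gt0.
  have -> : gamma * tau%:R * (2 * L) = 2 * (gamma * L * tau%:R) by ring.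
  by move: gLtau_le; lra.
have al1 : al <= 1.
  have h : mu * gamma <= gamma * tau%:R * mu.
    rewrite mulrC ler_pM2r // -[leLHS]mulr1 ler_pM2l //.
    by rewrite ler1n.
  by rewrite /al; move: h gtm; lra.
have vmu0 : 0 <= v / mu by rewrite divr_ge0 // ltW.
have slack_le : 64 * (gamma * tau%:R) * v <= 2 * (v / mu).
  have -> : 64 * (gamma * tau%:R) * v = 64 * (gamma * tau%:R * mu) * (v / mu).
    by field; rewrite gt_eqF.
  by rewrite ler_wpM2r //; move: gtm; lra.
(* Any [w] with [al * w] at least the noise per step, [12 * gamma * v], plus
   [al] times the slack between the potential and the gap serves here. *)
pose w := 170 * (v / mu).
have w0 : 0 <= w by exact: mulr_ge0.
have alv : al * (v / mu) = gamma * v / 12 by rewrite /al; field; rewrite gt_eqF.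
have alw : al * w = 170 * (al * (v / mu)) by rewrite /w; ring.
have gv0 : 0 <= gamma * v by rewrite mulr_ge0 // ltW.
have step t : (tau <= t)%N -> (t <= N)%N ->
    potential t.+1 - w <= (1 - al) * (potential t - w).
  move=> taut tN.
  have h1 := potential_decrease (leq_trans tau_gt0 taut) tN.
  have h2 : gamma / 2 * (2 * mu * gap t) <= gamma / 2 * sqgrad t.
    by rewrite ler_pM2l // divr_gt0.
  have e : gamma / 2 * (2 * mu * gap t) = 12 * (al * gap t).
    by rewrite /al; field.
  have h3 : al * potential t <= al * (5 / 4 * gap t + 2 * (v / mu)).
    rewrite ler_pM2l //.
    by have := potential_le t; lra.
  have h4 : 0 <= al * gap t by rewrite mulr_ge0 // ltW.
  have e2 : al * (5 / 4 * gap t + 2 * (v / mu)) =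
      5 / 4 * (al * gap t) + 2 * (al * (v / mu)) by ring.
  have e3 : (1 - al) * (potential t - w) =
      potential t - w - al * potential t + 170 * (al * (v / mu)).
    by rewrite -alw; ring.
  rewrite e3; move: h1 h2 h3; rewrite e e2 alv.
  move: h4 gv0; move: (al * gap t) (al * potential t) (gamma * v) => x y z.
  by move: (gamma / 2 * _) => s1; lra.
have iter k : (tau + k <= N)%N ->
    potential (tau + k) - w <= (1 - al) ^+ k * (potential tau - w).
  elim: k => [|k IH] kN; first by rewrite addn0 expr0 mul1r.
  rewrite addnS; rewrite addnS in kN.
  apply: le_trans (step _ (leq_addr _ _) (ltnW kN)) _.
  by rewrite exprS -mulrA ler_wpM2l ?subr_ge0 // IH // ltnW.
have := iter (T - tau)%N; rewrite subnKC ?(ltnW tauT) // => /(_ TN) hT.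
rewrite -/al; set rk := (1 - al) ^+ (T - tau) in hT *.
have rk0 : 0 <= rk by rewrite exprn_ge0 // subr_ge0.
have rk1 : rk <= 1.
  by apply: exprn_ile1; rewrite ?subr_ge0 // lerBlDr lerDl ltW.
have h1 : rk * (potential tau - w) <= 5 / 4 * (rk * gap tau) + 2 * (v / mu).
  apply: (@le_trans _ _ (rk * (5 / 4 * gap tau + 2 * (v / mu)))).
    rewrite ler_wpM2l //.
    by have := potential_le tau; lra.
  have h : rk * (v / mu) <= v / mu by rewrite ler_piMl.
  by rewrite mulrDr mulrCA (mulrCA rk 2); move: h; lra.
have h3 : 0 <= rk * gap tau by rewrite mulr_ge0.
move: (potential_ge T) slack_le h1 h3 hT vmu0; rewrite /w; lra.
Qed.

End LyapunovRecursion.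

(** * Mean behaviour of the method *)

Section MeanEstimates.
Context {R : realType} {d m n : nat} {W : finType}.
Variables (f : 'I_n -> 'rV[R]_d -> R) (Li : 'I_n -> R).
Variables (L delta sigma : R) (xstar : 'rV[R]_d).

Hypothesis n_gt0 : (0 < n)%N.
Hypothesis m_gt0 : (0 < m)%N.
Hypothesis m_le_d : (m <= d)%N.
Hypothesis df : forall i x, differentiable (f i) x.
Hypothesis lip_fi : forall i x y,
  nsq (grad (f i) x - grad (f i) y) <= Li i ^+ 2 * nsq (x - y).
Hypothesis L_gt0 : 0 < L.
Hypothesis L_avg : L ^+ 2 = n%:R^-1 * \sum_(i < n) Li i ^+ 2.
Hypothesis hetero : forall i x,
  nsq (grad (f i) x - grad (favg f) x) <=
    delta ^+ 2 * nsq (grad (favg f) x) + sigma ^+ 2.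
Hypothesis xstar_min : forall y, favg f xstar <= favg f y.

Let D : R := d%:R / m%:R.

Variables (gamma : R) (tau : nat).
Hypothesis gamma_gt0 : 0 < gamma.
Hypothesis tau_gt0 : (0 < tau)%N.
Let eta : R := gamma * L * tau%:R * D ^+ 2.
Hypothesis eta_small : eta * (delta ^+ 2 + 1) <= 64^-1.

Variables (K : 'I_n -> mask_set d m -> mask_set d m -> R).
Hypothesis trK : forall i, transition_matrix (K i).
Variable a : 'I_n -> 'I_d -> mask_set d m -> R.
Hypothesis a_poisson : forall i j A,
  a i j A - kop (K i) (a i j) A = D * (j \in val A)%:R - 1.
Hypothesis a_le : forall i j A, `|a i j A| <= 2 * tau%:R * D.

Variables (q : W -> R) (nu : 'I_n -> nat -> W -> mask_set d m) (N : nat).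
Hypothesis q_ge0 : forall h, 0 <= q h.
Hypothesis q_sum1 : \sum_h q h = 1.
Hypothesis markov : forall t i (X : W -> R) (b : mask_set d m -> R), (t < N)%N ->
  (forall h h', (forall i s, (s <= t)%N -> nu i s h = nu i s h') -> X h = X h') ->
  wmean q (fun h => X h * b (nu i t.+1 h)) =
  wmean q (fun h => X h * kop (K i) b (nu i t h)).

Variable x_ : nat -> W -> 'rV[R]_d.
Hypothesis x_step : forall t h, x_ t.+1 h =
  x_ t h - gamma *: wavg f (fun i j => D * (j \in val (nu i t h))%:R) (x_ t h).
Hypothesis x_adapted : forall t h h',
  (forall i s, (s < t)%N -> nu i s h = nu i s h') -> x_ t h = x_ t h'.

Let G x := grad (favg f) x.

Let D_ge1 : 1 <= D.
Proof. by rewrite /D ler_pdivlMr ?ltr0n // mul1r ler_nat. Qed.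

Let mask_le i t h (j : 'I_d) : `|D * (j \in val (nu i t h))%:R| <= D.
Proof.
have D0 : 0 <= D by exact: le_trans D_ge1.
by case: (j \in _); rewrite ?mulr1 ?mulr0 ?normr0 // ger0_norm.
Qed.

Let ka_le i j A : `|kop (K i) (a i j) A| <= 2 * tau%:R * D.
Proof. by apply: (kop_le_sup (trK i)) => A'; exact: a_le. Qed.

Definition correction (b : 'I_n -> 'I_d -> mask_set d m -> R) t s h : R :=
  dotp (grad (favg f) (x_ t h)) (wavg f (fun i j => b i j (nu i s h)) (x_ t h)).

Let ka i j := kop (K i) (a i j).

(** The iterate at time [t + 1] is determined by the masks up to time [t], so
    the Markov property averages the corrector over the mask at time [t + 1].
    *)
Lemma mean_correction t : (t < N)%N ->
  wmean q (correction a t.+1 t.+1) = wmean q (correction ka t.+1 t).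
Proof.
move=> tN.
have cE b s : correction b t.+1 s = fun h => \sum_i \sum_j
    (n%:R^-1 * (G (x_ t.+1 h) 0 j * grad (f i) (x_ t.+1 h) 0 j)) * b i j (nu i s h).
  apply/funext => h; rewrite /correction /wavg dotpZr dotp_sumr mulr_sumr.
  apply: eq_bigr => i _; rewrite /dotp mulr_sumr; apply: eq_bigr => j _.
  by rewrite /G !mxE; ring.
have eX i j := @markov t i (fun h => n%:R^-1 *
  (G (x_ t.+1 h) 0 j * grad (f i) (x_ t.+1 h) 0 j)) (a i j) tN.
rewrite !cE !wmean_sum; apply: eq_bigr => i _.
rewrite !wmean_sum; apply: eq_bigr => j _.
rewrite eX; first reflexivity.
by move=> h h' e; rewrite (@x_adapted t.+1 h h').
Qed.

Definition gap t : R := wmean q (fun h => favg f (x_ t h) - favg f xstar).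

(** The correction is averaged over the next mask given the previous one, so
    it involves only masks that also determine the iterate. At time 0, where
    there is no previous mask, [t.-1] gives a value without meaning. *)
Definition potential t : R :=
  gap t - gamma * wmean q (correction ka t t.-1).

Definition sqgrad t : R := wmean q (fun h => nsq (G (x_ t h))).

Lemma potential_decrease t : (0 < t)%N -> (t <= N)%N ->
  potential t.+1 <= potential t - gamma / 2 * sqgrad t + 12 * gamma * eta * sigma ^+ 2.
Proof.
case: t => // t _ tN.
have step h : favg f (x_ t.+2 h) - favg f xstar - gamma * correction ka t.+2 t.+1 h <=
    favg f (x_ t.+1 h) - favg f xstar - gamma * correction a t.+1 t.+1 h
    - gamma / 2 * nsq (G (x_ t.+1 h)) + 12 * gamma * eta * sigma ^+ 2.
  have := potential_step n_gt0 df lip_fi L_gt0 L_avg hetero D_ge1 gamma_gt0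
    tau_gt0 eta_small (x_ t.+1 h)
    (bq := fun i j => D * (j \in val (nu i t.+1 h))%:R) (fun i j => mask_le i t.+1 h j)
    (b := fun i j => a i j (nu i t.+1 h)) (b' := fun i j => ka i j (nu i t.+1 h))
    (fun i j => ka_le i j _) (fun i j => a_poisson i j _).
  rewrite -x_step -/eta => h1.
  rewrite (addrAC _ (- favg f xstar)) (addrAC (favg f (x_ t.+1 h))).
  rewrite -!(addrAC _ _ (- favg f xstar)).
  by rewrite lerBrDr subrK.
have corrE b s u : wmean q (fun h => favg f (x_ s h) - favg f xstar
    - gamma * correction b s u h) = gap s - gamma * wmean q (correction b s u).
  by rewrite (wmeanB q (fun h => favg f (x_ s h) - favg f xstar)) wmeanZ.
have := le_wmean q_ge0 step; rewrite [leRHS]wmeanD wmean_cst // corrE.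
rewrite (wmeanB q (fun h => favg f (x_ t.+1 h) - favg f xstar
  - gamma * correction a t.+1 t.+1 h)) corrE wmeanZ mean_correction //.
Qed.

Lemma gap_ge0 t : 0 <= gap t.
Proof. by apply: wmean_ge0 => // h; rewrite subr_ge0. Qed.

Let slack : R := 64 * gamma * tau%:R * eta * sigma ^+ 2.

Lemma potential_gap_close t : `|potential t - gap t| <= gap t / 4 + slack.
Proof.
rewrite /potential addrAC subrr add0r normrN -wmeanZ.
apply: (@le_trans _ _ (wmean q (fun h => `|gamma * correction ka t t.-1 h|))).
  apply: le_trans (ler_norm_sum _ _ _) _.
  by apply: ler_sum => h _; rewrite normrM ger0_norm.
have -> : gap t / 4 + slack = wmean q (fun h =>
    4^-1 * (favg f (x_ t h) - favg f xstar) + slack).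
  by rewrite wmeanD wmeanZ wmean_cst // mulrC.
apply: le_wmean => // h; rewrite (mulrC 4^-1).
exact: (corrector_le n_gt0 df lip_fi L_gt0 L_avg hetero xstar_min D_ge1 gamma_gt0
    tau_gt0 eta_small (x_ t h) (fun i j => ka_le i j _)).
Qed.

Lemma sqgrad_le t : sqgrad t <= 4 * L * gap t.
Proof.
rewrite /gap -wmeanZ; apply: le_wmean => // h.
exact: (nsq_grad_favg_le n_gt0 df lip_fi L_gt0 L_avg xstar_min).
Qed.

Lemma early_sqgrad_le :
  \sum_(t < tau) sqgrad t <= tau%:R * (3 * sqgrad tau + 8 * eta * sigma ^+ 2).
Proof.
rewrite -wmean_sum.
have -> : tau%:R * (3 * sqgrad tau + 8 * eta * sigma ^+ 2) =
    wmean q (fun h => tau%:R * (3 * nsq (G (x_ tau h)) + 8 * eta * sigma ^+ 2)).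
  by rewrite wmeanZ wmeanD wmeanZ wmean_cst.
apply: le_wmean => // h /=.
apply: (early_gradients_le n_gt0 df lip_fi L_gt0 L_avg D_ge1
  gamma_gt0 tau_gt0 eta_small (x := fun t => x_ t h) (fun t => x_step t h)) => t.
by apply: (nsq_wavg_le n_gt0 hetero) => i j; exact: mask_le.
Qed.

End MeanEstimates.

(** * The method along a trajectory of the masks *)

Lemma eq_qsgd {R : realType} {d m n : nat} {Om1 Om2 : Type}
    (f : 'I_n -> 'rV[R]_d -> R) (nu1 : 'I_n -> nat -> Om1 -> mask_set d m)
    (nu2 : 'I_n -> nat -> Om2 -> mask_set d m) gamma x0 t w1 w2 :
  (forall i s, (s < t)%N -> nu1 i s w1 = nu2 i s w2) ->
  qsgd f nu1 gamma x0 t w1 = qsgd f nu2 gamma x0 t w2.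
Proof.
elim: t => [//|t IH] e /=; rewrite IH; last first.
  by move=> i s st; apply: e; exact: ltnW.
by congr (_ - _ *: (_ *: _)); apply: eq_bigr => i _; rewrite e.
Qed.

Lemma qsgd_step {R : realType} {d m n : nat} {Om : Type}
    (f : 'I_n -> 'rV[R]_d -> R) (nu : 'I_n -> nat -> Om -> mask_set d m)
    gamma x0 t w :
  qsgd f nu gamma x0 t.+1 w = qsgd f nu gamma x0 t w - gamma *:
    wavg f (fun i j => d%:R / m%:R * (j \in val (nu i t w))%:R)
      (qsgd f nu gamma x0 t w).
Proof.
rewrite /= /wavg; congr (_ - _ *: (_ *: _)); apply: eq_bigr => i _.
by apply/rowP => j; rewrite !mxE; ring.
Qed.

Lemma mixing_sum_le {R : realType} {S : finType} (K : S -> S -> R) eps tm tau :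
  0 < eps -> mixing_time K uniform_distribution eps tm -> (tm <= tau)%N ->
  forall s, \sum_u `|kstep K tau s u - uniform_distribution u| <= eps.
Proof.
move=> e0 mix tmtau s; have S0 : 0 < #|S|%:R :> R.
  by rewrite ltr0n; apply/card_gt0P; exists s.
have -> : eps = \sum_(u : S) eps * #|S|%:R^-1.
  by rewrite sumr_const -[(_ * _) *+ _]mulr_natr mulfVK // gt_eqF.
apply: ler_sum => u _; apply: le_trans (mix _ tmtau s u) _.
by rewrite ler_pM2l //; apply: bigmin_le.
Qed.

Section Convergence.
Context {R : realType} {n d m : nat}.
Variables (f : 'I_n -> 'rV[R]_d -> R) (Li : 'I_n -> R).
Variables (L delta sigma : R) (xstar x0 : 'rV[R]_d).
Context {disp : measure_display} {Omega : measurableType disp}.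
Variables (P : probability Omega R) (nu : 'I_n -> nat -> Omega -> mask_set d m).
Variable K : 'I_n -> mask_set d m -> mask_set d m -> R.

Hypothesis n_gt0 : (0 < n)%N.
Hypothesis m_gt0 : (0 < m)%N.
Hypothesis m_le_d : (m <= d)%N.
Hypothesis df : forall i x, differentiable (f i) x.
Hypothesis lip_fi : forall i x y,
  nsq (grad (f i) x - grad (f i) y) <= Li i ^+ 2 * nsq (x - y).
Hypothesis L_gt0 : 0 < L.
Hypothesis L_avg : L ^+ 2 = n%:R^-1 * \sum_(i < n) Li i ^+ 2.
Hypothesis hetero : forall i x,
  nsq (grad (f i) x - grad (favg f) x) <=
    delta ^+ 2 * nsq (grad (favg f) x) + sigma ^+ 2.
Hypothesis xstar_min : forall y, favg f xstar <= favg f y.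
Hypothesis mnu : measurable_process nu.
Hypothesis trK : forall i, transition_matrix (K i).
Hypothesis statK : forall i, stationary_distribution (K i) uniform_distribution.
Hypothesis markovK : forall i, markov_chain P nu i (K i).

Let D : R := d%:R / m%:R.
Variables (gamma : R) (tau T : nat).
Hypothesis gamma_gt0 : 0 < gamma.
Hypothesis tau_gt0 : (0 < tau)%N.
Let eta : R := gamma * L * tau%:R * D ^+ 2.
Hypothesis eta_small : eta * (delta ^+ 2 + 1) <= 64^-1.
Hypothesis mixK : forall i s,
  \sum_u `|kstep (K i) tau s u - uniform_distribution u| <= 2^-1.

Let D_ge1 : 1 <= D.
Proof. by rewrite /D ler_pdivlMr ?ltr0n // mul1r ler_nat. Qed.

(** The error of the sparsification of one coordinate has mean zero, takes
    values in [[-1, D - 1]], and so has a Poisson solution bounded by [2 tau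
    D]. *)
Lemma mask_corrector : exists a : 'I_n -> 'I_d -> mask_set d m -> R,
  (forall i j A, a i j A - kop (K i) (a i j) A = D * (j \in val A)%:R - 1) /\
  (forall i j A, `|a i j A| <= 2 * tau%:R * D).
Proof.
have ex i j : exists h : mask_set d m -> R,
    (forall A, h A - kop (K i) h A = D * (j \in val A)%:R - 1) /\
    (forall A, `|h A| <= 2 * tau%:R * D).
  have mean0 : \sum_(A : mask_set d m)
      uniform_distribution A * (D * (j \in val A)%:R - 1) = 0 :> R.
    by rewrite /uniform_distribution -mulr_sumr sum_mask_unbiased ?mulr0.
  have bound (A : mask_set d m) : `|D * (j \in val A)%:R - 1| <= D.
    have D0 : 0 <= D by exact: le_trans D_ge1.
    case: (j \in _); rewrite ?mulr1 ?mulr0 ?sub0r ?normrN1 //.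
    by rewrite ger0_norm ?subr_ge0 // gerBl.
  have [h h1 h2] := poisson_equation (trK i) (statK i) (mixK i) mean0 bound.
  by exists h.
have exi i : exists g : 'I_d -> mask_set d m -> R, forall j,
    (forall A, g j A - kop (K i) (g j) A = D * (j \in val A)%:R - 1) /\
    (forall A, `|g j A| <= 2 * tau%:R * D).
  by have [g gP] := choice (ex i); exists g.
have [a aP] := choice exi.
by exists a; split=> i j; have [] := aP i j.
Qed.

(** The passage from expectations on [Omega] to means over the finitely many
    trajectories up to time [T], where the estimates on the potential apply.
    *)
Lemma lyapunov_data : exists potential gap sqgrad : nat -> R,
  [/\ forall t, (t <= T)%N -> Fgap P f nu xstar x0 gamma t = (gap t)%:E,
      forall J : Omega -> 'I_T.+1, uniform_index P nu J ->
        'E_P[fun w =>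
          (enorm (grad (favg f) (qsgd f nu gamma x0 (J w) w)) ^+ 2)%R]%E =
        (T.+1%:R^-1 * \sum_(t < T.+1) sqgrad t)%:E
    & forall mu, (forall x, 2 * mu * (favg f x - favg f xstar) <=
          nsq (grad (favg f) x)) -> forall t, 2 * mu * gap t <= sqgrad t] /\
  [/\ forall t, 0 <= gap t,
      forall t, sqgrad t <= 4 * L * gap t,
      forall t, `|potential t - gap t| <=
        gap t / 4 + 64 * (gamma * tau%:R) * (eta * sigma ^+ 2),
      forall t, (0 < t)%N -> (t <= T)%N -> potential t.+1 <=
        potential t - gamma / 2 * sqgrad t + 12 * (gamma * (eta * sigma ^+ 2))
    & \sum_(t < tau) sqgrad t <=
        tau%:R * (3 * sqgrad tau + 8 * (eta * sigma ^+ 2))].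
Proof.
have [a [a_poisson a_le]] := mask_corrector.
pose nuW i t (h : @traj n (mask_set d m) T) : mask_set d m := traj_at i t h.
pose x_ := qsgd f nuW gamma x0.
pose q := @traj_law _ _ _ P _ _ nu T.
have q_ge0 h : 0 <= q h by exact: traj_law_ge0.
have q_sum1 : \sum_h q h = 1 by exact: traj_law_sum1.
have x_step t h := qsgd_step f nuW gamma x0 t h.
have x_adapted t h h' : (forall i s, (s < t)%N -> nuW i s h = nuW i s h') ->
  x_ t h = x_ t h' by exact: eq_qsgd.
have mk t i := @traj_markov _ _ _ P _ _ nu mnu T i (K i) (markovK i) t.
have xE t w : (t <= T)%N -> qsgd f nu gamma x0 t w = x_ t (traj_of nu T w).
  move=> tT; apply: eq_qsgd => i s st.
  by rewrite /nuW traj_ofE // (leq_trans (ltnW st)).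
exists (potential f xstar gamma K a q nuW x_), (gap f xstar q x_), (sqgrad f q x_).
split; first split.
- move=> t tT; rewrite /Fgap /gap -(expectation_traj P mnu).
  by congr ('E_P[_])%E; apply/funext => w; rewrite xE.
- move=> J uJ.
  rewrite -(expectation_uniform_index mnu (fun t h => nsq (grad (favg f) (x_ t h))) uJ).
  congr ('E_P[_])%E; apply/funext => w.
  by rewrite enorm_sqr xE // -ltnS.
- move=> mu PL t; rewrite /gap -wmeanZ; apply: le_wmean => // h; exact: PL.
split.
- by move=> t; apply: gap_ge0.
- by move=> t; apply: (sqgrad_le n_gt0 df lip_fi L_gt0 L_avg xstar_min q_ge0).
- move=> t; have := potential_gap_close n_gt0 m_gt0 m_le_d df lip_fi L_gt0 L_avg
    hetero xstar_min gamma_gt0 tau_gt0 eta_small trK a_le nuW q_ge0 q_sum1 x_ t.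
  by rewrite -!mulrA.
- move=> t t_gt0 tT; have := potential_decrease xstar n_gt0 m_gt0 m_le_d df lip_fi
    L_gt0 L_avg hetero gamma_gt0 tau_gt0 eta_small trK a_poisson a_le
    q_ge0 q_sum1 mk x_step x_adapted t_gt0 tT.
  by rewrite -!mulrA.
- have := early_sqgrad_le n_gt0 m_gt0 m_le_d df lip_fi L_gt0 L_avg hetero
    gamma_gt0 tau_gt0 eta_small q_ge0 q_sum1 x_step.
  by rewrite -!mulrA.
Qed.

End Convergence.

(** * Step sizes, tolerances and the rates *)

Lemma step_size_small {R : realType} (d m : nat) (L A gamma c t : R) :
  (0 < m)%N -> (0 < d)%N -> 0 < L -> 0 < A -> 0 < t ->
  gamma <= c * (m%:R ^+ 2 / (d%:R ^+ 2 * L * A * t)) ->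
  gamma * L * t * (d%:R / m%:R) ^+ 2 * A <= c.
Proof.
move=> m0 d0 L0 A0 t0; rewrite mulrA ler_pdivlMr; last first.
  have D0 : 0 < d%:R ^+ 2 :> R by rewrite exprn_gt0 // ltr0n.
  exact: (mulr_gt0 (mulr_gt0 (mulr_gt0 D0 L0) A0) t0).
have M0 : 0 < m%:R ^+ 2 :> R by rewrite exprn_gt0 // ltr0n.
rewrite -ler_pdivrMr // => h; apply: le_trans h; rewrite le_eqVlt.
by apply/orP; left; apply/eqP; field; rewrite pnatr_eq0 -lt0n.
Qed.

Lemma tolerance1_le {R : realType} (d m : nat) (A c : R) :
  (0 < m)%N -> (m <= d)%N -> 1 <= A -> 0 <= c ->
  c * (m%:R ^+ 2 / (d%:R ^+ 2 * A)) <= c.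
Proof.
move=> m0 md A1 c0; rewrite ler_piMr //.
have A0 : 0 < A by exact: lt_le_trans ltr01 A1.
have D0 : 0 < d%:R ^+ 2 :> R by rewrite exprn_gt0 // ltr0n (leq_trans m0).
rewrite (ler_pdivrMr _ _ (mulr_gt0 D0 A0)) mul1r.
apply: (@le_trans _ _ (d%:R ^+ 2)); last by rewrite ler_peMr // ltW.
by rewrite lerXn2r ?nnegrE // ler_nat.
Qed.

Lemma tolerance2_le {R : realType} (d m : nat) (A c : R) :
  (0 < m)%N -> (m <= d)%N -> 1 <= A -> 0 <= c ->
  c * (m%:R / (d%:R * Num.sqrt A)) <= c.
Proof.
move=> m0 md A1 c0; rewrite ler_piMr //.
have s1 : 1 <= Num.sqrt A by rewrite -[1]sqrtr1 ler_wsqrtr.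
have D0 : 0 < d%:R :> R by rewrite ltr0n (leq_trans m0).
have s0 := lt_le_trans ltr01 s1.
rewrite ler_pdivrMr ?mulr_gt0 // mul1r.
apply: (@le_trans _ _ d%:R); last by rewrite ler_peMr // ltW.
by rewrite ler_nat.
Qed.

Theorem theorem3 (R : realType) :
  exists c C : R, [/\ 0 < c, 0 < C &
  forall (n d m : nat) (f : 'I_n -> 'rV[R]_d -> R) (Li : 'I_n -> R)
    (L delta sigma : R) (xstar x0 : 'rV[R]_d)
    (disp : measure_display) (Omega : measurableType disp)
    (P : probability Omega R) (nu : 'I_n -> nat -> Omega -> mask_set d m)
    (K : 'I_n -> mask_set d m -> mask_set d m -> R) (taumix : R -> nat),
  (0 < n)%N -> (1 <= m <= d)%N ->
  (forall i, 0 < Li i) ->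
  (forall i x, differentiable (f i) x) ->
  (forall i x y,
     enorm (grad (f i) x - grad (f i) y) ^+ 2 <= Li i ^+ 2 * enorm (x - y) ^+ 2) ->
  0 <= L -> L ^+ 2 = n%:R^-1 * \sum_(i < n) Li i ^+ 2 ->
  0 <= delta -> 0 <= sigma ->
  (forall i x,
     enorm (grad (f i) x - grad (favg f) x) ^+ 2 <=
       delta ^+ 2 * enorm (grad (favg f) x) ^+ 2 + sigma ^+ 2) ->
  (forall y, favg f xstar <= favg f y) ->
  measurable_process nu ->
  (forall i, transition_matrix (K i)) ->
  (forall i, ergodic_chain (K i)) ->
  (forall i, stationary_distribution (K i) uniform_distribution) ->
  (forall i, markov_chain P nu i (K i)) ->
  (forall eps i, 0 < eps -> mixing_time (K i) uniform_distribution eps (taumix eps)) ->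
  (forall (eps gamma : R) (tau T : nat),
     0 < eps -> 0 < gamma -> (taumix eps < tau)%N -> (tau < T)%N ->
     gamma <= c * (m%:R ^+ 2 / (d%:R ^+ 2 * L * (delta ^+ 2 + 1) * tau%:R)) ->
     eps <= c * (m%:R ^+ 2 / (d%:R ^+ 2 * (delta ^+ 2 + 1))) ->
     forall J : Omega -> 'I_T.+1, uniform_index P nu J ->
     ('E_P[fun w => (enorm (grad (favg f) (qsgd f nu gamma x0 (J w) w)) ^+ 2)%R]
      <= C%:E * (Fgap P f nu xstar x0 gamma tau * (gamma * T%:R)^-1%:E
           + (gamma * L * tau%:R * d%:R ^+ 2 / m%:R ^+ 2 * sigma ^+ 2)%:E))%E)
  /\
  (forall mu : R, 0 < mu ->
     (forall x,
        2 * mu * (favg f x - favg f xstar) <= enorm (grad (favg f) x) ^+ 2) ->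
     forall (eps gamma : R) (tau T : nat),
     0 < eps -> 0 < gamma -> (taumix eps < tau)%N -> (tau < T)%N ->
     gamma <= c * (m%:R ^+ 2 / (L * d%:R ^+ 2 * tau%:R * (delta ^+ 2 + 1))) ->
     eps = Num.sqrt (gamma * L * tau%:R) ->
     eps <= c * (m%:R / (d%:R * Num.sqrt (delta ^+ 2 + 1))) ->
     (Fgap P f nu xstar x0 gamma T
      <= C%:E * (((1 - mu * gamma / 12) ^+ (T - tau))%:E
                   * Fgap P f nu xstar x0 gamma tau
           + (gamma * d%:R ^+ 2 * L * tau%:R / (mu * m%:R ^+ 2)
                * sigma ^+ 2)%:E))%E)].
Proof.
exists 64^-1, 300; split; first by rewrite invr_gt0 ltr0n.
  by rewrite ltr0n.
move=> n d m f Li L delta sigma xstar x0 disp Omega P nu K taumix.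
move=> n_gt0 /andP[m_gt0 m_le_d] Li_gt0 df lip L_ge0 L_avg delta_ge0 sigma_ge0.
move=> het xmin mnu trK _ statK markovK mixK.
have d_gt0 : (0 < d)%N := leq_trans m_gt0 m_le_d.
have A_ge1 : 1 <= delta ^+ 2 + 1 by rewrite lerDr sqr_ge0.
have A_gt0 : 0 < delta ^+ 2 + 1 := lt_le_trans ltr01 A_ge1.
have c_ge0 : 0 <= 64^-1 :> R by rewrite invr_ge0.
have L_gt0 : 0 < L.
  rewrite lt_neqAle L_ge0 andbT eq_sym -sqrf_eq0 L_avg gt_eqF //.
  rewrite mulr_gt0 ?invr_gt0 ?ltr0n // (bigD1 (Ordinal n_gt0)) //=.
  by rewrite ltr_wpDr ?exprn_gt0 // sumr_ge0 // => i _; exact: sqr_ge0.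
have lip' i x y :
    nsq (grad (f i) x - grad (f i) y) <= Li i ^+ 2 * nsq (x - y).
  by rewrite -!enorm_sqr.
have het' i x : nsq (grad (f i) x - grad (favg f) x) <=
    delta ^+ 2 * nsq (grad (favg f) x) + sigma ^+ 2.
  by rewrite -!enorm_sqr.
have half eps (tau : nat) : 0 < eps -> (taumix eps < tau)%N -> eps <= 64^-1 ->
    forall i s, \sum_u `|kstep (K i) tau s u - uniform_distribution u| <= 2^-1.
  move=> e0 tmtau eps_le i s.
  apply: le_trans (mixing_sum_le e0 (mixK _ i e0) (ltnW tmtau) s) _.
  by apply: le_trans eps_le _; rewrite lef_pV2 ?posrE // ler_nat.
have noise_ge0 gamma (tau : nat) : 0 < gamma ->
    0 <= gamma * L * tau%:R * (d%:R / m%:R) ^+ 2 * sigma ^+ 2.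
  by move=> g0; rewrite mulr_ge0 ?sqr_ge0 // mulr_ge0 ?sqr_ge0 // !mulr_ge0 // ltW.
have gLtau gamma (tau : nat) : 0 < gamma -> (0 < tau)%N ->
    gamma * L * tau%:R * (d%:R / m%:R) ^+ 2 * (delta ^+ 2 + 1) <= 64^-1 ->
    gamma * L * tau%:R <= 64^-1.
  move=> g0 tau_gt0; apply: le_trans; rewrite -[leLHS]mulr1 -[leRHS]mulrA.
  rewrite ler_pM2l; last by rewrite !mulr_gt0 // ltr0n.
  apply: mulr_ege1 => //; rewrite exprn_ege1 //.
  by rewrite ler_pdivlMr ?ltr0n // mul1r ler_nat.
split.
- move=> eps gamma tau T eps_gt0 gamma_gt0 tmtau tauT gamma_le eps_le J uJ.
  have tau_gt0 : (0 < tau)%N by exact: leq_ltn_trans tmtau.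
  have eta_small : gamma * L * tau%:R * (d%:R / m%:R) ^+ 2 * (delta ^+ 2 + 1) <= 64^-1.
    by apply: step_size_small => //; rewrite ltr0n.
  have half' := half eps tau eps_gt0 tmtau
    (le_trans eps_le (tolerance1_le m_gt0 m_le_d A_ge1 c_ge0)).
  have [pot [gap [sqg [[gapE sqgE _] [gap0 sqgl close dec early]]]]] :=
    lyapunov_data x0 n_gt0 m_gt0 m_le_d df lip' L_gt0 L_avg het' xmin mnu trK statK
      markovK T gamma_gt0 tau_gt0 eta_small half'.
  have := sum_sqgrad_le gamma_gt0 tau_gt0 (noise_ge0 gamma tau gamma_gt0)
    (gLtau gamma tau gamma_gt0 tau_gt0 eta_small) gap0 sqgl close dec early tauT (leqnn T).
  have v0 := noise_ge0 gamma tau gamma_gt0.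
  have T0 : 0 < T%:R :> R by rewrite ltr0n (leq_trans tau_gt0) // ltnW.
  rewrite sqgE // gapE ?(ltnW tauT) //.
  rewrite -[X in (_ <= X)%E]/(300 * (gap tau * (gamma * T%:R)^-1 +
    gamma * L * tau%:R * d%:R ^+ 2 / m%:R ^+ 2 * sigma ^+ 2))%:E lee_fin.
  have -> : gamma * L * tau%:R * d%:R ^+ 2 / m%:R ^+ 2 * sigma ^+ 2 =
      gamma * L * tau%:R * (d%:R / m%:R) ^+ 2 * sigma ^+ 2.
    by field; rewrite pnatr_eq0 -lt0n.
  move: v0; set v := _ * sigma ^+ 2 => v0 sum_le.
  have rhs0 : 0 <= 300 * (gap tau / gamma + T%:R * v).
    apply: mulr_ge0; first exact: ler0n.
    apply: addr_ge0; first exact: divr_ge0 (gap0 _) (ltW gamma_gt0).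
    exact: mulr_ge0 (ltW T0) v0.
  have -> : 300 * (gap tau * (gamma * T%:R)^-1 + v) =
      T%:R^-1 * (300 * (gap tau / gamma + T%:R * v)).
    by field; rewrite !gt_eqF.
  apply: (@le_trans _ _ (T.+1%:R^-1 * (300 * (gap tau / gamma + T%:R * v)))).
    by rewrite ler_pM2l // invr_gt0 ltr0n.
  apply: ler_wpM2r; first exact: rhs0.
  by rewrite lef_pV2 ?posrE ?ltr0Sn // ler_nat.
- move=> mu mu_gt0 PL eps gamma tau T eps_gt0 gamma_gt0 tmtau tauT gamma_le _ eps_le.
  have tau_gt0 : (0 < tau)%N by exact: leq_ltn_trans tmtau.
  have PL' x : 2 * mu * (favg f x - favg f xstar) <= nsq (grad (favg f) x).
    by rewrite -enorm_sqr.
  have eta_small : gamma * L * tau%:R * (d%:R / m%:R) ^+ 2 * (delta ^+ 2 + 1) <= 64^-1.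
    apply: step_size_small => //; rewrite ?ltr0n //.
    apply: le_trans gamma_le _; rewrite le_eqVlt; apply/orP; left; apply/eqP.
    by congr (_ * (_ / _)); ring.
  have half' := half eps tau eps_gt0 tmtau
    (le_trans eps_le (tolerance2_le m_gt0 m_le_d A_ge1 c_ge0)).
  have [pot [gap [sqg [[gapE _ sqgPL] [gap0 sqgl close dec _]]]]] :=
    lyapunov_data x0 n_gt0 m_gt0 m_le_d df lip' L_gt0 L_avg het' xmin mnu trK statK
      markovK T gamma_gt0 tau_gt0 eta_small half'.
  have v0 := noise_ge0 gamma tau gamma_gt0.
  rewrite !gapE ?(ltnW tauT) //.
  rewrite -[X in (_ <= X)%E]/(300 * ((1 - mu * gamma / 12) ^+ (T - tau) * gap tau +
    gamma * d%:R ^+ 2 * L * tau%:R / (mu * m%:R ^+ 2) * sigma ^+ 2))%:E lee_fin.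
  have -> : gamma * d%:R ^+ 2 * L * tau%:R / (mu * m%:R ^+ 2) * sigma ^+ 2 =
      gamma * L * tau%:R * (d%:R / m%:R) ^+ 2 * sigma ^+ 2 / mu.
    by field; rewrite gt_eqF // pnatr_eq0 -lt0n.
  have [mu_le|mu_gt] := leP mu (2 * L).
    exact: (gap_le_PL gamma_gt0 tau_gt0 v0
      (gLtau gamma tau gamma_gt0 tau_gt0 eta_small) gap0 close dec mu_gt0 mu_le
      (sqgPL mu PL') tauT (leqnn T)).
  (* Here [2 mu gap <= sqgrad <= 4 L gap] with [2 L < mu], so all gaps vanish. This
     case is separate because [1 - mu gamma / 12] may be negative in it. *)
  have gap_eq0 t : gap t = 0.
    apply/eqP; rewrite eq_le gap0 andbT leNgt; apply/negP => gt0.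
    have := le_trans (sqgPL mu PL' t) (sqgl t).
    have -> : 4 * L = 2 * (2 * L) by ring.
    by rewrite ler_pM2r // ler_pM2l // leNgt mu_gt.
  rewrite !gap_eq0 mulr0 add0r; apply: mulr_ge0; first exact: ler0n.
  exact: divr_ge0 v0 (ltW mu_gt0).
Qed.
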